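(* Let $G$ be a triangle-free subdivision of $K_4$. Then $G$ is a restricted frame graph if and only if either (1) $G$ is obtained from $K_4$ by subdividing at most $3$ of its $6$ edges, or (2) $G$ is obtained from $K_4$ by subdividing exactly $4$ of its edges and the two non-subdivided edges share a vertex.
   Context: A subdivision of $K_4$ is obtained by replacing each edge of $K_4$ by a path; an edge is subdivided if its path has at least two edges. A frame is the boundary of an axis-parallel box $I\times J\subset\mathbb R^2$. A graph $G$ is a restricted frame graph if there is a family of frames $\{F_v : v\in V(G)\}$ with $uv\in E(G)$ iff $F_u\cap F_v\neq\emptyset$, satisfying: (1) corners of a frame do not coincide with any point of another frame; (2) the left side of any frame does not intersect any other frame; (3) if the right side of a frame intersects a second frame, this right side intersects both the top and the bottom side of the second frame; (4) if two frames have non-empty intersection, then no frame is entirely contained in the intersection of the two regions bounded by these two frames. *)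

(* Defs.v *)
From Stdlib Require Import Reals.
From mathcomp Require Import all_boot.
Set Implicit Arguments. Unset Strict Implicit. Unset Printing Implicit Defensive.

Definition triangle_free (T : finType) (e : rel T) : Prop :=
  forall x y z : T, ~ (e x y /\ e y z /\ e z x).

Definition consec (T : eqType) (L : seq T) (x y : T) : Prop :=
  exists k, (k.+1 < size L)%N /\ nth x L k = x /\ nth x L k.+1 = y.

(* Witness that (T,e) is a subdivision of K4: the branch vertices are
   b 0, .., b 3, and for i < j the edge ij of K4 is replaced by the path
   b i :: s i j ++ [:: b j]  (s i j = sequence of internal vertices). *)
Definition K4path (T : finType) (b : 'I_4 -> T) (s : 'I_4 -> 'I_4 -> seq T)
  (i j : 'I_4) : seq T := b i :: rcons (s i j) (b j).

Definition K4_subdivision_witness (T : finType) (e : rel T)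
  (b : 'I_4 -> T) (s : 'I_4 -> 'I_4 -> seq T) : Prop :=
  injective b /\
  (forall i j : 'I_4, (i < j)%N -> uniq (s i j)) /\
  (forall (i j : 'I_4) (k : 'I_4), (i < j)%N -> b k \notin s i j) /\
  (forall i j k l : 'I_4, (i < j)%N -> (k < l)%N -> (i, j) <> (k, l) ->
      forall x, x \in s i j -> x \notin s k l) /\
  (forall x : T, (exists k, x = b k) \/
                 (exists i j : 'I_4, (i < j)%N /\ x \in s i j)) /\
  (forall x y : T, e x y <->
      exists i j : 'I_4, (i < j)%N /\
        (consec (K4path b s i j) x y \/ consec (K4path b s i j) y x)).

Definition is_K4_subdivision (T : finType) (e : rel T) : Prop :=
  exists b s, @K4_subdivision_witness T e b s.

Definition subdivided (T : finType) (s : 'I_4 -> 'I_4 -> seq T) (i j : 'I_4) : bool :=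
  if (i < j)%N then s i j != [::] else s j i != [::].

Definition num_subdivided (T : finType) (s : 'I_4 -> 'I_4 -> seq T) : nat :=
  #|[set p : 'I_4 * 'I_4 | (p.1 < p.2)%N && subdivided s p.1 p.2]|.

Definition nonsubdivided_share_vertex (T : finType) (s : 'I_4 -> 'I_4 -> seq T) : Prop :=
  exists a c d : 'I_4, [/\ a != c, a != d, c != d,
                           ~~ subdivided s a c & ~~ subdivided s a d].

(* Frames: boundaries of axis-parallel boxes [x1,x2] x [y1,y2].         *)

Record frame := Frame { fx1 : R; fx2 : R; fy1 : R; fy2 : R }.

Definition frame_ok (F : frame) : Prop :=
  Rlt (fx1 F) (fx2 F) /\ Rlt (fy1 F) (fy2 F).

Definition between (a t c : R) : Prop := Rle a t /\ Rle t c.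

Definition on_left (F : frame) (p : R * R) : Prop :=
  p.1 = fx1 F /\ between (fy1 F) p.2 (fy2 F).
Definition on_right (F : frame) (p : R * R) : Prop :=
  p.1 = fx2 F /\ between (fy1 F) p.2 (fy2 F).
Definition on_bottom (F : frame) (p : R * R) : Prop :=
  p.2 = fy1 F /\ between (fx1 F) p.1 (fx2 F).
Definition on_top (F : frame) (p : R * R) : Prop :=
  p.2 = fy2 F /\ between (fx1 F) p.1 (fx2 F).

Definition on_frame (F : frame) (p : R * R) : Prop :=
  on_left F p \/ on_right F p \/ on_bottom F p \/ on_top F p.

Definition in_region (F : frame) (p : R * R) : Prop :=
  between (fx1 F) p.1 (fx2 F) /\ between (fy1 F) p.2 (fy2 F).

Definition is_corner (F : frame) (p : R * R) : Prop :=
  (p.1 = fx1 F \/ p.1 = fx2 F) /\ (p.2 = fy1 F \/ p.2 = fy2 F).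

Definition meets (P Q : R * R -> Prop) : Prop := exists p, P p /\ Q p.

Definition restricted_frame_graph (T : finType) (e : rel T) : Prop :=
  exists F : T -> frame,
  (forall v, frame_ok (F v)) /\
      (forall u v, u <> v -> (e u v <-> meets (on_frame (F u)) (on_frame (F v)))) /\
      (forall u v, u <> v -> forall p, is_corner (F u) p -> ~ on_frame (F v) p) /\
      (forall u v, u <> v -> ~ meets (on_left (F u)) (on_frame (F v))) /\
      (forall u v, u <> v -> meets (on_right (F u)) (on_frame (F v)) ->
          meets (on_right (F u)) (on_bottom (F v)) /\
          meets (on_right (F u)) (on_top (F v))) /\
      (forall u v w, u <> v -> meets (on_frame (F u)) (on_frame (F v)) ->
          w <> u -> w <> v ->
          ~ (forall p, on_frame (F w) p -> in_region (F u) p /\ in_region (F v) p)).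

(* Main.v *)
Require Import Defs.
From HB Require Import structures.
From Stdlib Require Import Reals Lra.
From mathcomp Require Import all_boot zify.
Set Implicit Arguments. Unset Strict Implicit. Unset Printing Implicit Defensive.

(** Both conditions say that some branch vertex a has two unsubdivided edges.

    Two adjacent frames u, v satisfy x1 u < x1 v < x2 u < x2 v (or the converse), with the
    vertical range of v inside that of u; two non-adjacent ones are nested or apart.  If no
    branch vertex has two unsubdivided edges, the non-neighbours of any vertex v induce a
    connected graph, so a frame enclosing one of its non-neighbours encloses all of them.
    By axiom (4) there is at most one enclosing vertex.  But every cycle contains one: the
    vertex of maximal x1 on it has two in-neighbours, and these are nested.  The cycles of
    the subdivision have no vertex in common, a contradiction.

    Conversely, let ac and ad be unsubdivided and f be the fourth branch vertex, and let w be
    the neighbour of c on the path from d to c.  Three y-disjoint chains of boxes start at the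
    right side of the frame of f: one ends with c, one passes through d and ends next to w,
    one runs towards a.  The frame of w encloses the frame of a, and their right sides cut the
    chains at the required boxes; the frame of f lies inside that of a, except when af is
    unsubdivided, where a sticks out of f. *)

(** * Relative positions of two frames, and the axioms derived from them *)

Definition frame_arc (F G : frame) : Prop :=
  [/\ Rlt (fx1 F) (fx1 G), Rlt (fx1 G) (fx2 F), Rlt (fx2 F) (fx2 G),
      Rlt (fy1 F) (fy1 G) & Rlt (fy2 G) (fy2 F)].

Definition inside (F G : frame) : Prop :=
  [/\ Rlt (fx1 G) (fx1 F), Rlt (fx2 F) (fx2 G),
      Rlt (fy1 G) (fy1 F) & Rlt (fy2 F) (fy2 G)].

Definition apart (F G : frame) : Prop :=
  Rlt (fx2 F) (fx1 G) \/ Rlt (fx2 G) (fx1 F) \/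
  Rlt (fy2 F) (fy1 G) \/ Rlt (fy2 G) (fy1 F).

Ltac unfold_frames :=
  rewrite /is_corner /on_frame /on_left /on_right /on_bottom /on_top
    /in_region /between /=.

Lemma arc_meets F G : frame_ok F -> frame_ok G -> frame_arc F G ->
  meets (on_frame F) (on_frame G).
Proof.
move=> [? ?] [? ?] [? ? ? ? ?]; exists (fx2 F, fy1 G); unfold_frames; lra.
Qed.

Lemma meets_sym P Q : meets P Q -> meets Q P.
Proof. by case=> p [? ?]; exists p. Qed.

Lemma inside_not_meets F G : frame_ok F -> frame_ok G -> inside F G ->
  ~ meets (on_frame F) (on_frame G).
Proof.
move=> [? ?] [? ?] [? ? ? ?] [[p q]]; unfold_frames => -[hF hG].
case: hF => [?|[?|[?|?]]]; case: hG => [?|[?|[?|?]]]; lra.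
Qed.

Lemma apart_not_meets F G : frame_ok F -> frame_ok G -> apart F G ->
  ~ meets (on_frame F) (on_frame G).
Proof.
move=> [? ?] [? ?] hA [[p q]]; unfold_frames => -[hF hG].
have [[? ?] [? ?]] : between (fx1 F) p (fx2 F) /\ between (fy1 F) q (fy2 F).
  by rewrite /between; case: hF => [?|[?|[?|?]]]; lra.
have [[? ?] [? ?]] : between (fx1 G) p (fx2 G) /\ between (fy1 G) q (fy2 G).
  by rewrite /between; case: hG => [?|[?|[?|?]]]; lra.
by case: hA => [?|[?|[?|?]]]; lra.
Qed.

(** These turn out to be all the positions that the axioms allow for two frames. Only the first one
    lets the frames meet, so axioms (1) to (3) need a computation in that case alone. *)
Definition placed (F G : frame) : Prop :=
  [\/ frame_arc F G \/ frame_arc G F, inside F G, inside G F | apart F G].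

Lemma placed_corner F G p : frame_ok F -> frame_ok G -> placed F G ->
  is_corner F p -> ~ on_frame G p.
Proof.
move=> hF hG pl hc hp.
have hFp : on_frame F p.
  move: hc hF; case: p {hp} => p q; rewrite /frame_ok; unfold_frames.
  by move=> [[?|?] [?|?]] [? ?]; lra.
have mt : meets (on_frame F) (on_frame G) by exists p.
case: pl => [pl|pl|pl|pl].
- case: p hc hp {hFp mt} => p q; move: hF hG; rewrite /frame_ok; unfold_frames.
  move=> [? ?] [? ?].
  case: pl => -[? ? ? ? ?] [[?|?] [?|?]] [?|[?|[?|?]]]; lra.
- exact: (inside_not_meets hF hG pl).
- exact: (inside_not_meets hG hF pl (meets_sym mt)).
- exact: (apart_not_meets hF hG pl).
Qed.

Lemma placed_left F G : frame_ok F -> frame_ok G -> placed F G ->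
  ~ meets (on_left F) (on_frame G).
Proof.
move=> hF hG pl [p [hl hp]].
have mt : meets (on_frame F) (on_frame G) by exists p; split => //; left.
case: pl => [pl|pl|pl|pl].
- case: p hl hp {mt} => p q; move: hF hG; rewrite /frame_ok; unfold_frames.
  move=> [? ?] [? ?].
  case: pl => -[? ? ? ? ?] [? ?] [?|[?|[?|?]]]; lra.
- exact: (inside_not_meets hF hG pl).
- exact: (inside_not_meets hG hF pl (meets_sym mt)).
- exact: (apart_not_meets hF hG pl).
Qed.

Lemma placed_right F G : frame_ok F -> frame_ok G -> placed F G ->
  meets (on_right F) (on_frame G) ->
  meets (on_right F) (on_bottom G) /\ meets (on_right F) (on_top G).
Proof.
move=> hF hG pl [p [hl hp]].
have mt : meets (on_frame F) (on_frame G) by exists p; split => //; right; left.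
case: pl => [pl|pl|pl|pl].
- case: p hl hp {mt} => p q; move: hF hG; rewrite /frame_ok; unfold_frames.
  move=> [? ?] [? ?].
  case: pl => -[? ? ? ? ?] [? ?] h.
    (* The right side of [F] cuts through [G] at abscissa [fx2 F]; for an arc from [G] to [F] it
       lies strictly to the right of [G]. *)
    by split; [exists (fx2 F, fy1 G)|exists (fx2 F, fy2 G)]; unfold_frames; lra.
  by case: h => [?|[?|[?|?]]]; lra.
- by case: (inside_not_meets hF hG pl).
- by case: (inside_not_meets hG hF pl (meets_sym mt)).
- by case: (apart_not_meets hF hG pl).
Qed.

(** Two opposite corners of [H] already give all four bounds. *)
Lemma region_bounds F H : frame_ok H -> (forall p, on_frame H p -> in_region F p) ->
  [/\ Rle (fx1 F) (fx1 H), Rle (fx2 H) (fx2 F), Rle (fy1 F) (fy1 H) &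
      Rle (fy2 H) (fy2 F)].
Proof.
move=> [? ?] h.
have /h : on_frame H (fx1 H, fy1 H) by unfold_frames; lra.
have /h : on_frame H (fx2 H, fy2 H) by unfold_frames; lra.
unfold_frames => *; split; lra.
Qed.

(** Reduces a representation to strict inequalities between coordinates. The last hypothesis is
    axiom (4) with containment made strict. *)
Lemma restricted_frame_graph_of_placed (T : finType) (e : rel T) (F : T -> frame) :
  (forall v, frame_ok (F v)) ->
  (forall u v, e u v -> frame_arc (F u) (F v) \/ frame_arc (F v) (F u)) ->
  (forall u v, u <> v -> ~~ e u v ->
     [\/ inside (F u) (F v), inside (F v) (F u) | apart (F u) (F v)]) ->
  (forall u v w, e u v -> inside (F w) (F u) -> inside (F w) (F v) -> False) ->
  restricted_frame_graph e.
Proof.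
move=> ok earc enon e4; exists F.
have emeet u v : u <> v -> e u v <-> meets (on_frame (F u)) (on_frame (F v)).
  move=> uv; split.
    by move=> /earc[|] a; [|apply: meets_sym]; apply: arc_meets.
  move=> mt; case E : (e u v) => //; case: (enon u v uv (negbT E)) => h.
  - by case: (inside_not_meets (ok u) (ok v) h).
  - by case: (inside_not_meets (ok v) (ok u) h); apply: meets_sym.
  - by case: (apart_not_meets (ok u) (ok v) h).
have pl u v : u <> v -> placed (F u) (F v).
  move=> uv; case E : (e u v); first by constructor 1; apply: earc.
  by case: (enon u v uv (negbT E)) => ?; [constructor 2|constructor 3|constructor 4].
split=> //; split=> //; split; last split; last split.
- move=> u v uv p; exact: (placed_corner (ok u) (ok v) (pl _ _ uv)).
- move=> u v uv; exact: (placed_left (ok u) (ok v) (pl _ _ uv)).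
- move=> u v uv; exact: (placed_right (ok u) (ok v) (pl _ _ uv)).
move=> u v w uv /(emeet _ _ uv) euv wu wv h.
have hu := region_bounds (ok w) (fun p hp => proj1 (h p hp)).
have hv := region_bounds (ok w) (fun p hp => proj2 (h p hp)).
(* Weak containment is strict, because it contradicts every other position of the two frames. *)
have nest x : w <> x -> [/\ Rle (fx1 (F x)) (fx1 (F w)), Rle (fx2 (F w)) (fx2 (F x)),
    Rle (fy1 (F x)) (fy1 (F w)) & Rle (fy2 (F w)) (fy2 (F x))] -> inside (F w) (F x).
  move=> wx [? ? ? ?]; move: (ok w) (ok x) => [? ?] [? ?].
  case: (pl _ _ wx) => // [[]|[]|].
  - by case=> *; lra.
  - by case=> *; lra.
  - by move=> *; lra.
  - by case=> [?|[?|[?|?]]]; lra.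
exact: (e4 u v w euv (nest u wu hu) (nest v wv hv)).
Qed.

(** * Positions forced by the axioms *)

Section Necessary.
Variables (T : finType) (e : rel T) (F : T -> frame).
Hypothesis ok : forall v, frame_ok (F v).
Hypothesis emeet : forall u v, u <> v ->
  (e u v <-> meets (on_frame (F u)) (on_frame (F v))).
Hypothesis corner : forall u v, u <> v ->
  forall p, is_corner (F u) p -> ~ on_frame (F v) p.
Hypothesis left_free : forall u v, u <> v -> ~ meets (on_left (F u)) (on_frame (F v)).
Hypothesis right_through : forall u v, u <> v -> meets (on_right (F u)) (on_frame (F v)) ->
  meets (on_right (F u)) (on_bottom (F v)) /\ meets (on_right (F u)) (on_top (F v)).

(** Axiom (3) gives the last four inequalities in weak form, and equality in one of them would put a
    corner of one frame on the other. The first holds because otherwise the bottom side of [F v]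
    would reach the left side of [F u], against axiom (2). *)
Lemma right_meets_arc u v : u <> v -> meets (on_right (F u)) (on_frame (F v)) ->
  frame_arc (F u) (F v).
Proof.
move=> uv /(right_through uv)[[[p1 q1] [h1 h2]] [[p2 q2] [h3 h4]]].
have vu : v <> u by move=> E; apply: uv.
move: h1 h2 h3 h4; unfold_frames => -[? [? ?]] [? [? ?]] [? [? ?]] [? [? ?]].
have [? ?] := ok u; have [? ?] := ok v.
have c1 : ~ on_frame (F u) (fx1 (F v), fy1 (F v)).
  by apply: (corner vu); split; left.
have c2 : ~ on_frame (F u) (fx2 (F v), fy1 (F v)).
  by apply: (corner vu); split; [right|left].
have c3 : ~ on_frame (F v) (fx2 (F u), fy1 (F u)).
  by apply: (corner uv); split; [right|left].
have c4 : ~ on_frame (F v) (fx2 (F u), fy2 (F u)).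
  by apply: (corner uv); split; right.
have c5 : ~ (on_left (F u) (fx1 (F u), fy1 (F v)) /\ on_frame (F v) (fx1 (F u), fy1 (F v))).
  by move=> h; apply: (left_free uv); eexists; exact: h.
split; apply: Rnot_le_lt => ?.
- by apply: c5; split; [|right; right; left]; unfold_frames; lra.
- by apply: c1; right; left; unfold_frames; lra.
- by apply: c2; right; left; unfold_frames; lra.
- by apply: c3; right; right; left; unfold_frames; lra.
- by apply: c4; right; right; right; unfold_frames; lra.
Qed.

(** A common point lies on no left side, and on a right side it yields an arc. There remains a point
    on horizontal sides of both frames: these sides are collinear, and the left end of the one
    starting further right is a corner lying on the other frame. *)
Lemma edge_arc u v : u <> v -> e u v -> frame_arc (F u) (F v) \/ frame_arc (F v) (F u).
Proof.
move=> uv /(emeet uv)[[p q] [hu hv]].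
have vu : v <> u by move=> E; apply: uv.
have [? ?] := ok u; have [? ?] := ok v.
have nl : ~ on_left (F u) (p, q) by move=> h; apply: (left_free uv); exists (p, q).
have nl' : ~ on_left (F v) (p, q) by move=> h; apply: (left_free vu); exists (p, q).
case: (hu) => [/nl[]|[r|hu']].
  by left; apply: right_meets_arc => //; exists (p, q).
case: (hv) => [/nl'[]|[r|hv']].
  by right; apply: right_meets_arc => //; exists (p, q).
exfalso.
have c1 : ~ on_frame (F v) (fx1 (F u), q).
  apply: (corner uv); split; [by left|].
  by case: hu' => -[/= -> _]; [left|right].
have c2 : ~ on_frame (F u) (fx1 (F v), q).
  apply: (corner vu); split; [by left|].
  by case: hv' => -[/= -> _]; [left|right].
have [? ?] : between (fx1 (F u)) p (fx2 (F u)) by case: hu' => -[_].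
have [? ?] : between (fx1 (F v)) p (fx2 (F v)) by case: hv' => -[_].
case: (Rle_dec (fx1 (F u)) (fx1 (F v))) => ?.
- by apply: c2; right; right; case: hu' => -[/= -> _]; [left|right]; unfold_frames; lra.
- by apply: c1; right; right; case: hv' => -[/= -> _]; [left|right]; unfold_frames; lra.
Qed.

(** If the boxes overlap, the one whose left side is further right is the inner one: each failing
    inequality would make a vertical side of one frame cross a horizontal side of the other. *)
Lemma non_edge_placed u v : u <> v -> ~~ e u v ->
  [\/ inside (F u) (F v), inside (F v) (F u) | apart (F u) (F v)].
Proof.
move=> uv nuv.
have nm x y : on_frame (F u) (x, y) -> on_frame (F v) (x, y) -> False.
  by move=> h1 h2; move/negP: nuv; apply; apply/(emeet uv); exists (x, y).
have [A B] := ok u; have [C D] := ok v.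
move: (F u) (F v) A B C D nm => [a1 a2 c1 c2] [b1 b2 d1 d2] /= A B C D nm.
(* Here [(x, y)] is the crossing of a vertical side of the first frame with a horizontal side of the
   second; [k] exchanges the roles. *)
have h x y : x = a1 \/ x = a2 -> y = d1 \/ y = d2 ->
    between b1 x b2 -> between c1 y c2 -> False.
  move=> hx hy bx by_; apply: (nm x y).
  - by case: hx => ->; [left|right; left].
  - by right; right; case: hy => ->; [left|right].
have k x y : x = b1 \/ x = b2 -> y = c1 \/ y = c2 ->
    between a1 x a2 -> between d1 y d2 -> False.
  move=> hx hy bx by_; apply: (nm x y).
  - by right; right; case: hy => ->; [left|right].
  - by case: hx => ->; [left|right; left].
rewrite /inside /apart /=; rewrite /between in h k.
case: (Rlt_dec a2 b1) => ?; first by constructor 3; lra.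
case: (Rlt_dec b2 a1) => ?; first by constructor 3; lra.
case: (Rlt_dec c2 d1) => ?; first by constructor 3; lra.
case: (Rlt_dec d2 c1) => ?; first by constructor 3; lra.
case: (Rle_dec b1 a1) => ?.
- have ? : Rlt d1 c1 by apply: Rnot_le_lt => ?; apply: (h a1 d1); lra.
  have ? : Rlt c2 d2 by apply: Rnot_le_lt => ?; apply: (h a1 d2); lra.
  have ? : Rlt b1 a1 by apply: Rnot_le_lt => ?; apply: (k b1 c1); lra.
  have ? : Rlt a2 b2 by apply: Rnot_le_lt => ?; apply: (k b2 c1); lra.
  by constructor 1; split.
- have ? : Rlt c1 d1 by apply: Rnot_le_lt => ?; apply: (k b1 c1); lra.
  have ? : Rlt d2 c2 by apply: Rnot_le_lt => ?; apply: (k b1 c2); lra.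
  have ? : Rlt b2 a2 by apply: Rnot_le_lt => ?; apply: (h a2 d1); lra.
  by constructor 2; split; lra.
Qed.
End Necessary.

(** Converse of [restricted_frame_graph_of_placed]: from here on a representation is a system of
    inequalities. *)
Lemma restricted_frame_graph_placed (T : finType) (e : rel T) :
  restricted_frame_graph e ->
  exists F : T -> frame,
  [/\ forall v, frame_ok (F v),
      forall u v, u <> v -> e u v -> frame_arc (F u) (F v) \/ frame_arc (F v) (F u),
      forall u v, u <> v -> ~~ e u v ->
        [\/ inside (F u) (F v), inside (F v) (F u) | apart (F u) (F v)] &
      forall u v w, u <> v -> e u v -> inside (F w) (F u) -> inside (F w) (F v) -> False].
Proof.
move=> [F [ok [em [co [le [ri c4]]]]]]; exists F; split => //.
- move=> u v; exact: edge_arc.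
- move=> u v; exact: non_edge_placed.
move=> u v w uv /(em _ _ uv) mt iu iv.
have wu : w <> u by move=> E; subst w; case: iu => *; lra.
have wv : w <> v by move=> E; subst w; case: iv => *; lra.
apply: (c4 u v w uv mt wu wv) => -[p q].
have [? ?] := ok w; case: iu => ? ? ? ?; case: iv => ? ? ? ?.
unfold_frames => -[?|[?|[?|?]]]; lra.
Qed.

(** * Consecutive entries of a sequence, and index sets of size four *)

Lemma consecP (T : eqType) (L : seq T) x y :
  consec L x y <-> exists L1 L2, L = L1 ++ x :: y :: L2.
Proof.
split=> [[k [lt_k [hx hy]]]|[L1 [L2 ->]]].
  exists (take k L), (drop k.+2 L).
  by rewrite -[in LHS](cat_take_drop k L) (drop_nth x (ltnW lt_k)) (drop_nth x lt_k) hx hy.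
exists (size L1); rewrite size_cat !nth_cat ltnn subnn subSnn.
by rewrite (ltn_geF (leqnSn _)) /=; split=> //; lia.
Qed.

Lemma consec_rev (T : eqType) (L : seq T) x y : consec (rev L) x y -> consec L y x.
Proof.
move/consecP => [L1 [L2 E]]; apply/consecP; exists (rev L2), (rev L1).
by rewrite -[LHS]revK E rev_cat !rev_cons -!cats1 -!catA.
Qed.

Lemma consec_mem (T : eqType) (L : seq T) x y : consec L x y -> x \in L /\ y \in L.
Proof. by move/consecP=> [L1 [L2 ->]]; rewrite !mem_cat !inE !eqxx !orbT. Qed.

Lemma consec_index (T : eqType) (L : seq T) x y : uniq L -> consec L x y ->
  index y L = (index x L).+1.
Proof.
move=> uL [k [lt_k [hx hy]]].
by rewrite -[in LHS]hy index_uniq // -[in RHS]hx index_uniq // ltnW.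
Qed.

Lemma index_consec (T : eqType) (L : seq T) x y : y \in L ->
  index y L = (index x L).+1 -> consec L x y.
Proof.
move=> yL E; exists (index x L).
have lt_y : (index y L < size L)%N by rewrite index_mem.
have xL : x \in L by rewrite -index_mem; lia.
by rewrite -E lt_y !nth_index.
Qed.

Lemma ord4_cover (i j k l : 'I_4) : uniq [:: i; j; k; l] ->
  forall x, x \in [:: i; j; k; l].
Proof.
move=> u x.
have [] := @uniq_min_size _ [:: i; j; k; l] (enum 'I_4) u.
- by move=> y _; rewrite mem_enum.
- by rewrite size_enum_ord.
- by move=> _ ->; rewrite mem_enum.
Qed.

Lemma ord4_extend (i j : 'I_4) : i != j -> exists k l, uniq [:: i; j; k; l].
Proof.
move=> ij; case: (pickP (fun p : 'I_4 * 'I_4 => uniq [:: i; j; p.1; p.2])).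
  by case=> k l ?; exists k, l.
move=> h; exfalso.
(* One of the six pairs is the complement of [i] and [j]. *)
have h0 := h (@Ordinal 4 0 isT, @Ordinal 4 1 isT).
have h1 := h (@Ordinal 4 0 isT, @Ordinal 4 2 isT).
have h2 := h (@Ordinal 4 0 isT, @Ordinal 4 3 isT).
have h3 := h (@Ordinal 4 1 isT, @Ordinal 4 2 isT).
have h4 := h (@Ordinal 4 1 isT, @Ordinal 4 3 isT).
have h5 := h (@Ordinal 4 2 isT, @Ordinal 4 3 isT).
move: ij h0 h1 h2 h3 h4 h5.
by case: i {h} => [[|[|[|[|//]]]] ?]; case: j => [[|[|[|[|//]]]] ?].
Qed.

(** A witness constrains [s] only above the diagonal. Reading each path in both directions frees the
    later arguments from the order on ['I_4]; on the diagonal the value is arbitrary. *)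
Definition sym_paths (T : finType) (s : 'I_4 -> 'I_4 -> seq T) (i j : 'I_4) : seq T :=
  if (i < j)%N then s i j else rev (s j i).

(** * Paths, internal vertices and edges of a subdivision *)

Section Subdivision.
Variables (T : finType) (e : rel T) (b : 'I_4 -> T) (s : 'I_4 -> 'I_4 -> seq T).
Hypothesis W : K4_subdivision_witness e b s.
Notation sp := (sym_paths s).
Notation Q := (K4path b (sym_paths s)).

Let b_inj : injective b. Proof. by case: W. Qed.

Lemma sym_paths_lt (i j : 'I_4) : (i < j)%N -> sp i j = s i j.
Proof. by rewrite /sym_paths => ->. Qed.

Lemma sym_paths_gt (i j : 'I_4) : (j < i)%N -> sp i j = rev (s j i).
Proof. by rewrite /sym_paths => /ltnW; rewrite leqNgt => /negPf->. Qed.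

Lemma subdividedE (i j : 'I_4) : i != j -> subdivided s i j = (sp i j != [::]).
Proof.
rewrite /subdivided neq_ltn => /orP[ij|ji]; first by rewrite ij sym_paths_lt.
rewrite (sym_paths_gt ji) -!size_eq0 size_rev.
by have /ltnW := ji; rewrite leqNgt => /negPf->.
Qed.

Lemma sym_paths_rev i j : i != j -> sp j i = rev (sp i j).
Proof.
rewrite neq_ltn => /orP[ij|ji]; first by rewrite sym_paths_gt // sym_paths_lt.
by rewrite sym_paths_lt // sym_paths_gt // revK.
Qed.

Lemma K4path_rev i j : i != j -> Q j i = rev (Q i j).
Proof.
by move=> ij; rewrite /K4path (sym_paths_rev ij) rev_cons rev_rcons rcons_cons.
Qed.

Lemma branch_notin_path k i j : i != j -> b k \notin sp i j.
Proof.
case: W => _ [_ [h _]]; rewrite neq_ltn => /orP[ij|ji].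
  by rewrite sym_paths_lt ?h.
by rewrite sym_paths_gt // mem_rev h.
Qed.

Lemma sym_paths_uniq i j : i != j -> uniq (sp i j).
Proof.
case: W => _ [h _]; rewrite neq_ltn => /orP[ij|ji]; first by rewrite sym_paths_lt ?h.
by rewrite sym_paths_gt // rev_uniq h.
Qed.

Lemma K4path_uniq i j : i != j -> uniq (Q i j).
Proof.
move=> ij; rewrite /K4path cons_uniq rcons_uniq mem_rcons inE negb_or.
by rewrite !branch_notin_path // sym_paths_uniq // (inj_eq b_inj) ij.
Qed.

Lemma sym_paths_disjoint i j k l x : i != j -> k != l -> x \in sp i j -> x \in sp k l ->
  i = k /\ j = l \/ i = l /\ j = k.
Proof.
case: W => _ [_ [_ [h _]]].
have g (i' j' k' l' : 'I_4) : (i' < j')%N -> (k' < l')%N -> x \in s i' j' -> x \in s k' l' ->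
    i' = k' /\ j' = l'.
  move=> ij kl xi xk; have [[-> ->] //|/eqP ne] := eqVneq (i', j') (k', l').
  by move/negP: (h _ _ _ _ ij kl ne x xi).
rewrite !neq_ltn => /orP[] ij /orP[] kl.
- by rewrite !sym_paths_lt // => xi xk; left; apply: g.
- rewrite (sym_paths_lt ij) (sym_paths_gt kl) mem_rev => xi xk.
  by right; apply: g.
- rewrite (sym_paths_gt ij) (sym_paths_lt kl) mem_rev => xi xk.
  by right; case: (g _ _ _ _ ij kl xi xk).
- rewrite !sym_paths_gt // !mem_rev => xi xk.
  by left; case: (g _ _ _ _ ij kl xi xk).
Qed.

Lemma K4path_cover x : (exists k, x = b k) \/ exists i j, i != j /\ x \in sp i j.
Proof.
case: W => _ [_ [_ [_ [h _]]]]; case: (h x) => [|[i [j [ij xs]]]]; first by left.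
right; exists i, j; rewrite /sym_paths ij; split=> //.
by apply: contraTneq ij => ->; rewrite ltnn.
Qed.

Lemma K4_edgeP x y : e x y <-> exists i j, i != j /\ consec (Q i j) x y.
Proof.
case: W => _ [_ [_ [_ [_ h]]]]; rewrite h; split.
  move=> [i [j [ij c]]].
  have ne : i != j by apply: contraTneq ij => ->; rewrite ltnn.
  have E : K4path b s i j = Q i j by rewrite /K4path /sym_paths ij.
  rewrite E in c; case: c => c; first by exists i, j.
  exists j, i; rewrite eq_sym; split=> //; apply: consec_rev.
  by rewrite -K4path_rev // eq_sym.
move=> [i [j [ij c]]]; have := ij; rewrite neq_ltn => /orP[lt_ij|lt_ji].
  exists i, j; split=> //; left.
  by move: c; rewrite /K4path /sym_paths lt_ij.
exists j, i; split=> //; right; apply: consec_rev.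
have -> : K4path b s j i = Q j i by rewrite /K4path /sym_paths lt_ji.
by rewrite -K4path_rev // eq_sym.
Qed.

Lemma K4_edge_sym : symmetric e.
Proof.
suff h x y : e x y -> e y x by move=> x y; apply/idP/idP; apply: h.
move=> /K4_edgeP[i [j [ij c]]]; apply/K4_edgeP; exists j, i.
rewrite eq_sym; split=> //; apply: consec_rev.
by rewrite -K4path_rev // eq_sym.
Qed.

Lemma mem_K4path x i j : (x \in Q i j) = [|| x == b i, x == b j | x \in sp i j].
Proof. by rewrite /K4path inE mem_rcons inE. Qed.

Lemma branch_in_K4path k i j : i != j -> (b k \in Q i j) = (k == i) || (k == j).
Proof.
move=> ij; rewrite mem_K4path !(inj_eq b_inj) (negPf (branch_notin_path k ij)).
by rewrite orbF.
Qed.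

Lemma internal_in_K4path i j k l x : i != j -> k != l -> x \in sp i j -> x \in Q k l ->
  i = k /\ j = l \/ i = l /\ j = k.
Proof.
move=> ij kl xi; rewrite mem_K4path => /or3P[/eqP E|/eqP E|]; last exact: sym_paths_disjoint.
- by move: xi; rewrite E (negPf (branch_notin_path _ ij)).
- by move: xi; rewrite E (negPf (branch_notin_path _ ij)).
Qed.

Lemma K4_edge_irrefl x : ~~ e x x.
Proof.
apply/negP => /K4_edgeP[i [j [ij c]]].
by have := consec_index (K4path_uniq ij) c; lia.
Qed.

(** The paths of the subdivision are induced. The path carrying the edge is [Q i j] up to direction:
    an internal end determines its path, and two branch ends must be [b i] and [b j]. *)
Lemma K4_edge_consec i j x y : i != j -> x \in Q i j -> y \in Q i j -> e x y ->
  consec (Q i j) x y \/ consec (Q i j) y x.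
Proof.
move=> ij xi yi exy; have /K4_edgeP[k [l [kl c]]] := exy.
have [xk yk] := consec_mem c.
suff [[-> ->]|[E1 E2]] : i = k /\ j = l \/ i = l /\ j = k.
- by left.
- right; apply: consec_rev; rewrite -K4path_rev //.
  by rewrite E1 E2.
have [xs|nxs] := boolP (x \in sp i j); first exact: internal_in_K4path xs xk.
have [ys|nys] := boolP (y \in sp i j); first exact: internal_in_K4path ys yk.
have xb : x = b i \/ x = b j.
  by move: xi; rewrite mem_K4path (negPf nxs) orbF => /orP[]/eqP; auto.
have yb : y = b i \/ y = b j.
  by move: yi; rewrite mem_K4path (negPf nys) orbF => /orP[]/eqP; auto.
have xy : x != y by apply: contraTneq exy => ->; apply: K4_edge_irrefl.
by case: xb yb xk yk xy => -> [] -> ; rewrite ?eqxx // !branch_in_K4path //;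
  do 2![case/orP => /eqP ?]; subst; rewrite ?eqxx //; auto.
Qed.

Lemma internal_edge i j x y : i != j -> x \in sp i j -> e x y -> y \in Q i j.
Proof.
move=> ij xs /K4_edgeP[k [l [kl c]]]; have [xk yk] := consec_mem c.
case: (internal_in_K4path ij kl xs xk) => -[-> ->] //.
by rewrite K4path_rev ?mem_rev // eq_sym.
Qed.

Lemma index_path_start i j : index (b i) (Q i j) = 0.
Proof. by rewrite /K4path /= eqxx. Qed.

Lemma index_path_end i j : i != j -> index (b j) (Q i j) = (size (sp i j)).+1.
Proof.
move=> ij; rewrite /K4path /= (inj_eq b_inj) (negPf ij) -cats1 index_cat.
by rewrite (negPf (branch_notin_path _ ij)) /= eqxx addn0.
Qed.

Lemma branch_edge i j : i != j -> e (b i) (b j) = (sp i j == [::]).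
Proof.
move=> ij; apply/idP/eqP => [E|E].
  have [] := K4_edge_consec ij _ _ E; rewrite ?branch_in_K4path ?eqxx ?orbT //;
    move/(consec_index (K4path_uniq ij)); rewrite index_path_start index_path_end //.
  by case=> /size0nil.
apply/K4_edgeP; exists i, j; split=> //; rewrite /K4path E.
by apply/consecP; exists [::], [::].
Qed.

End Subdivision.

(** * Connectedness of the non-neighbours of a vertex *)

Section StarComplement.
Variables (T : finType) (e : rel T) (b : 'I_4 -> T) (s : 'I_4 -> 'I_4 -> seq T).
Hypothesis W : K4_subdivision_witness e b s.
Notation sp := (sym_paths s).
Notation Q := (K4path b (sym_paths s)).
Hypothesis isolated : forall i j k : 'I_4, i != j -> i != k -> j != k ->
  sp i j = [::] -> sp i k = [::] -> False.

Let b_inj : injective b. Proof. by case: W. Qed.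

(** If [v] is a branch vertex, it has two unsubdivided edges. If it is internal, its path has the
    ends [b i] and [b j], so [v] lies on [Q i j]. *)
Lemma no_common_branch_neighbour i j v : i != j -> v \notin Q i j ->
  e v (b i) -> e v (b j) -> False.
Proof.
move=> ij vQ ei ej; case: (K4path_cover W v) => [[k E]|[k [l [kl vs]]]].
  have [ki kj] : k != i /\ k != j.
    by apply/andP; move: vQ; rewrite E (branch_in_K4path W) // negb_or.
  move: ei ej; rewrite E !(branch_edge W) // => /eqP h1 /eqP h2.
  exact: (isolated ki kj ij h1 h2).
have := internal_edge W kl vs ei; have := internal_edge W kl vs ej.
rewrite !(branch_in_K4path W) // => hj hi; move/negP: vQ; apply.
have : v \in Q k l by rewrite mem_K4path vs !orbT.
have : v \in Q l k by rewrite (K4path_rev b s kl) mem_rev mem_K4path vs !orbT.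
by case/orP: hi ij => /eqP->; case/orP: hj => /eqP->; rewrite ?eqxx.
Qed.

Variable v : T.

Definition nonneighbour x := (x != v) && ~~ e v x.
Definition nonneighbour_step := [rel x y | [&& e x y, nonneighbour x & nonneighbour y]].
Notation ok := nonneighbour.
Notation r := nonneighbour_step.

Lemma nonneighbour_connect_sym : connect_sym r.
Proof. by apply: sym_connect_sym => x y; rewrite /= (K4_edge_sym W) [ok x && _]andbC. Qed.

Lemma K4path_walk i j p q : i != j -> (p <= q)%N -> (q < size (Q i j))%N ->
  (forall k, (p <= k <= q)%N -> ok (nth (b i) (Q i j) k)) ->
  connect r (nth (b i) (Q i j) p) (nth (b i) (Q i j) q).
Proof.
move=> ij; elim: q => [|q IH] pq qs h.
  by have -> : p = 0 by lia.
have [->//|ne] := eqVneq p q.+1.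
apply: connect_trans (IH _ _ _) _; try lia; first by move=> k ?; apply: h; lia.
apply: connect1; apply/and3P; split; [|by apply: h; lia..].
apply/(K4_edgeP W); exists i, j; split=> //.
apply: index_consec; first exact: mem_nth.
rewrite !index_uniq ?(K4path_uniq W) //.
exact: ltnW.
Qed.

Lemma internal_nonneighbour i j x : i != j -> v \notin Q i j -> x \in sp i j -> ok x.
Proof.
move=> ij vQ xs; apply/andP; split.
  by apply: contraNneq vQ => <-; rewrite mem_K4path xs !orbT.
by apply: contraNN vQ; rewrite (K4_edge_sym W); apply: (internal_edge W).
Qed.

Lemma K4path_nonneighbour i j x : i != j -> v \notin Q i j -> ok (b i) -> ok (b j) ->
  x \in Q i j -> ok x.
Proof.
move=> ij vQ oi oj; rewrite mem_K4path => /or3P[/eqP->|/eqP->|] //.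
exact: internal_nonneighbour.
Qed.

Lemma nth_path_end i j : nth (b i) (Q i j) (size (sp i j)).+1 = b j.
Proof. by rewrite /= nth_rcons ltnn eqxx. Qed.

Lemma size_path i j : size (Q i j) = (size (sp i j)).+2.
Proof. by rewrite /= size_rcons. Qed.

Lemma free_path_connect i j : i != j -> v \notin Q i j -> ok (b i) -> ok (b j) ->
  connect r (b i) (b j).
Proof.
move=> ij vQ oi oj; rewrite -[X in connect r _ X](nth_path_end i j).
apply: (@K4path_walk _ _ 0) => //; first by rewrite size_path.
move=> k hk; apply: (K4path_nonneighbour ij) => //.
by apply: mem_nth; rewrite size_path; lia.
Qed.

(** The direct path serves unless [v] is internal to it. In that case a third branch vertex gives a
    detour: the neighbours of [v] all lie on [Q i j]. *)
Lemma branches_connect i j : ok (b i) -> ok (b j) -> connect r (b i) (b j).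
Proof.
have [->//|ij] := eqVneq i j; move=> oi oj.
have [vQ|vQ] := boolP (v \in Q i j); last exact: free_path_connect.
have vs : v \in sp i j.
  move: vQ; rewrite mem_K4path => /or3P[/eqP E|/eqP E|//].
    by move: oi; rewrite /nonneighbour E eqxx.
  by move: oj; rewrite /nonneighbour E eqxx.
have [k [l u]] := ord4_extend ij.
have [ik jk] : i != k /\ j != k.
  by move: u; rewrite /= !inE !negb_or => /andP[/and3P[_ ? _] /andP[/andP[? _] _]].
have okk : ok (b k).
  apply/andP; split.
    by apply: contraTneq vs => <-; apply: (branch_notin_path W).
  apply/negP => /(internal_edge W ij vs); rewrite (branch_in_K4path W) //.
  by rewrite eq_sym (negPf ik) eq_sym (negPf jk).
apply: (@connect_trans _ _ (b k)).
  apply: free_path_connect => //; apply/negP => /(internal_in_K4path W ij ik vs).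
  by case=> -[E1 E2]; subst; rewrite eqxx in jk ik.
rewrite nonneighbour_connect_sym.
apply: free_path_connect => //; apply/negP => /(internal_in_K4path W ij jk vs).
by case=> -[E1 E2]; subst; rewrite eqxx in jk ik.
Qed.

(** The path being induced, only [v] and its neighbours along the path drop out. The form [k.+1] in
    the last condition avoids a truncated predecessor when [v] comes first. *)
Lemma nonneighbour_nth i j k : i != j -> v \in Q i j -> (k < size (Q i j))%N ->
  ok (nth (b i) (Q i j) k) =
  [&& k != index v (Q i j), k != (index v (Q i j)).+1 & k.+1 != index v (Q i j)].
Proof.
move=> ij vQ hk; have uQ := K4path_uniq W ij; set n := index v (Q i j).
have mk : nth (b i) (Q i j) k \in Q i j by apply: mem_nth.
have ik : index (nth (b i) (Q i j) k) (Q i j) = k by rewrite index_uniq.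
rewrite /nonneighbour; congr (_ && _).
  congr (~~ _); apply/eqP/eqP => [E|->]; first by rewrite -ik E.
  by rewrite nth_index.
rewrite -negb_or; congr (~~ _); apply/idP/orP => [h|[]/eqP E].
- case: (K4_edge_consec W ij vQ mk h) => /(consec_index uQ); rewrite ik => E.
    by left; apply/eqP.
  by right; apply/eqP.
- by apply/(K4_edgeP W); exists i, j; split=> //; apply: index_consec => //; rewrite ik.
- rewrite (K4_edge_sym W); apply/(K4_edgeP W); exists i, j; split=> //.
  by apply: index_consec => //; rewrite ik E.
Qed.

(** An internal [x] moves along its path: away from [v] if [v] lies on it, and otherwise towards an
    end not adjacent to [v], which exists by [no_common_branch_neighbour]. *)
Lemma reach_branch x : ok x -> exists k, ok (b k) /\ connect r x (b k).
Proof.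
move=> ox; case: (K4path_cover W x) => [[k E]|[i [j [ij xs]]]].
  by exists k; rewrite -E.
have uQ := K4path_uniq W ij.
have xQ : x \in Q i j by rewrite mem_K4path xs !orbT.
set q := index x (Q i j).
have qs : (q < size (Q i j))%N by rewrite index_mem.
have xq : nth (b i) (Q i j) q = x by rewrite nth_index.
have right_ : (forall k, (q <= k <= (size (sp i j)).+1)%N -> ok (nth (b i) (Q i j) k)) ->
    exists k, ok (b k) /\ connect r x (b k).
  move=> h; exists j; rewrite -(nth_path_end i j) -[X in connect _ X _]xq.
  rewrite size_path in qs.
  by split; [apply: h; lia | apply: K4path_walk => //; rewrite ?size_path; lia].
have left_ : (forall k, (0 <= k <= q)%N -> ok (nth (b i) (Q i j) k)) ->
    exists k, ok (b k) /\ connect r x (b k).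
  move=> h; exists i; have o0 : ok (b i) by apply: (h 0); lia.
  split=> //; rewrite nonneighbour_connect_sym -[X in connect _ _ X]xq.
  exact: (@K4path_walk _ _ 0).
have [vQ|vQ] := boolP (v \in Q i j).
  have := nonneighbour_nth ij vQ qs; rewrite xq ox => /esym ok_q.
  have [lt|ge] := ltnP (index v (Q i j)) q.
    by apply: right_ => k hk; rewrite nonneighbour_nth ?size_path //; lia.
  by apply: left_ => k hk; rewrite nonneighbour_nth //; lia.
have xi : x != b i by apply: contraTneq xs => ->; apply: (branch_notin_path W).
have xj : x != b j by apply: contraTneq xs => ->; apply: (branch_notin_path W).
have [bi bj] : b i != v /\ b j != v.
  by move: vQ; rewrite mem_K4path !negb_or ![v == _]eq_sym => /and3P[].
have [ei|ni] := boolP (e v (b i)).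
  have oj : ok (b j).
    by rewrite /nonneighbour bj; apply/negP => /(no_common_branch_neighbour ij vQ ei).
  apply: right_ => k hk; have : nth (b i) (Q i j) k \in Q i j.
    by apply: mem_nth; rewrite size_path ltnS; case/andP: hk.
  rewrite mem_K4path => /or3P[/eqP E|/eqP->|] //; last exact: internal_nonneighbour.
  (* The walk starts at [x] and moves forward, so meeting position 0 would force [x] to be [b i]. *)
  have k0 : index (nth (b i) (Q i j) k) (Q i j) = 0 by rewrite E index_path_start.
  rewrite index_uniq ?size_path in k0 => //; last by case/andP: hk.
  case/eqP: xi; rewrite -xq.
  by move: hk; rewrite k0 leqn0 => /andP[/eqP-> _].
have oi : ok (b i) by rewrite /nonneighbour bi.
apply: left_ => k hk; have : nth (b i) (Q i j) k \in Q i j.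
  by apply: mem_nth; apply: leq_ltn_trans qs; case/andP: hk.
rewrite mem_K4path => /or3P[/eqP->|/eqP E|] //; last exact: internal_nonneighbour.
have k0 : index (nth (b i) (Q i j) k) (Q i j) = (size (sp i j)).+1.
  by rewrite E (index_path_end W).
rewrite index_uniq in k0 => //; last by apply: leq_ltn_trans qs; case/andP: hk.
rewrite size_path in qs; case/eqP: xj; rewrite -xq -(nth_path_end i j).
by congr nth; clear -k0 hk qs; lia.
Qed.

Lemma nonneighbours_connect x y : ok x -> ok y -> connect r x y.
Proof.
move=> /reach_branch[i [oi xi]] /reach_branch[j [oj yj]].
apply: connect_trans xi _; apply: connect_trans (branches_connect oi oj) _.
by rewrite nonneighbour_connect_sym.
Qed.

End StarComplement.

(** * No representation when every branch vertex has at most one unsubdivided edge *)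

Lemma seq_max (T : eqType) (f : T -> R) (L : seq T) x0 : x0 \in L ->
  exists2 m, m \in L & forall y, y \in L -> Rle (f y) (f m).
Proof.
elim: L x0 => // a L IH x0 _; case: L IH => [_|a' L IH].
  by exists a; rewrite ?mem_head // => y; rewrite inE => /eqP->; lra.
have [m mL hm] := IH a' (mem_head _ _).
have [le|lt] := Rle_dec (f a) (f m).
  exists m; first by rewrite inE mL orbT.
  by move=> y; rewrite inE => /orP[/eqP-> //|/hm].
exists a; first exact: mem_head.
by move=> y; rewrite inE => /orP[/eqP->|/hm]; lra.
Qed.

Section NotFrameGraph.
Variables (T : finType) (e : rel T) (b : 'I_4 -> T) (s : 'I_4 -> 'I_4 -> seq T).
Hypothesis W : K4_subdivision_witness e b s.
Hypothesis tf : triangle_free e.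
Notation sp := (sym_paths s).
Notation Q := (K4path b (sym_paths s)).
Hypothesis isolated : forall i j k : 'I_4, i != j -> i != k -> j != k ->
  sp i j = [::] -> sp i k = [::] -> False.
Variable F : T -> frame.
Hypothesis F_ok : forall v, frame_ok (F v).
Hypothesis F_edge : forall u v, u <> v -> e u v -> frame_arc (F u) (F v) \/ frame_arc (F v) (F u).
Hypothesis F_nonedge : forall u v, u <> v -> ~~ e u v ->
  [\/ inside (F u) (F v), inside (F v) (F u) | apart (F u) (F v)].
Hypothesis F_nest : forall u v w, u <> v -> e u v ->
  inside (F w) (F u) -> inside (F w) (F v) -> False.

Let b_inj : injective b. Proof. by case: W. Qed.

Let edge_neq x y : e x y -> x <> y.
Proof. by move=> exy E; move: exy; rewrite E (negPf (K4_edge_irrefl W y)). Qed.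

(** The frames of [y] and [v] do not meet. As [F y] meets a frame inside [F v], the two are not
    apart, and [F y] cannot enclose [F v], since it would then enclose [F x] as well. *)
Lemma inside_step v x y : e x y -> nonneighbour e v y ->
  inside (F x) (F v) -> inside (F y) (F v).
Proof.
move=> exy /andP[/eqP yv nvy] [? ? ? ?].
have arcxy := F_edge (edge_neq exy) exy.
have [? ?] := F_ok x; have [? ?] := F_ok y; have [? ?] := F_ok v.
rewrite (K4_edge_sym W) in nvy; case: (F_nonedge yv nvy) => // [[? ? ? ?]|].
- by case: arcxy => -[? ? ? ? ?]; lra.
- by case: arcxy => -[? ? ? ? ?] [?|[?|[?|?]]]; lra.
Qed.

Lemma inside_nonneighbour v x : inside (F x) (F v) -> nonneighbour e v x.
Proof.
move=> [? ? ? ?]; apply/andP; split; first by apply/eqP => E; subst; lra.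
by apply/negP => h; case: (F_edge (edge_neq h) h) => -[? ? ? ? ?]; lra.
Qed.

(* The non-neighbours of v induce a connected graph, so a frame that encloses
   one of them encloses all of them. *)
Lemma inside_spread v x y : inside (F x) (F v) -> nonneighbour e v y ->
  inside (F y) (F v).
Proof.
move=> ix oy; have ox := inside_nonneighbour ix.
have /connectP[p pth ->] := nonneighbours_connect W isolated ox oy.
elim: p x pth ix {ox} => //= z p IH x /andP[/and3P[exz _ oz] pth] ix.
exact: IH pth (inside_step exz oz ix).
Qed.

(** The candidates are the two branch vertices off the path carrying the edge. Each fails only
    through an unsubdivided edge from an end of that path lying in [{u, v}]. If both fail through
    the same end, that end has two unsubdivided edges; if through different ends, the path itself is
    a single edge and again supplies a second one. *)
Lemma edge_common_nonneighbour u v : e u v ->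
  exists w, nonneighbour e u w /\ nonneighbour e v w.
Proof.
move=> euv; have /(K4_edgeP W)[i [j [ij c]]] := euv.
have [uQ vQ] := consec_mem c.
have [k [l U]] := ord4_extend ij.
have [[ik il] [jk jl] kl] : [/\ i != k /\ i != l, j != k /\ j != l & k != l].
  by move: U; rewrite /= !inE !negb_or => /and4P[/and3P[? ? ?] /andP[? ?] ? _].
have pn x m : x \in Q i j -> i != m -> j != m -> ~~ e x (b m) -> nonneighbour e x (b m).
  move=> xQ im jm h; rewrite /nonneighbour h andbT; apply: contraTneq xQ => <-.
  by rewrite (branch_in_K4path W) // negb_or ![m == _]eq_sym im.
have nb x m : x \in Q i j -> i != m -> j != m -> e x (b m) ->
    x = b i /\ sp i m = [::] \/ x = b j /\ sp j m = [::].
  move=> + im jm; rewrite mem_K4path => /or3P[/eqP->|/eqP->|xs].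
  - by rewrite (branch_edge W) // => /eqP; left.
  - by rewrite (branch_edge W) // => /eqP; right.
  - move/(internal_edge W ij xs); rewrite (branch_in_K4path W) // ![m == _]eq_sym.
    by rewrite (negPf im) (negPf jm).
have [/orP hk|hk] := boolP (e u (b k) || e v (b k)); last first.
  by move: hk; rewrite negb_or => /andP[? ?]; exists (b k); split; apply: pn.
have [/orP hl|hl] := boolP (e u (b l) || e v (b l)); last first.
  by move: hl; rewrite negb_or => /andP[? ?]; exists (b l); split; apply: pn.
exfalso.
have eb : e (b i) (b j) -> sp i j = [::] /\ sp j i = [::].
  by rewrite (branch_edge W) // (sym_paths_rev s ij) => /eqP->.
have ji : j != i by rewrite eq_sym.
have lk : l != k by rewrite eq_sym.
have both : b i \in [:: u; v] -> b j \in [:: u; v] -> e (b i) (b j).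
  have bij : b i != b j by rewrite (inj_eq b_inj).
  rewrite !inE => /orP[]/eqP Ei /orP[]/eqP Ej; move: bij; rewrite Ei Ej ?eqxx //.
  by rewrite (K4_edge_sym W).
have side m : i != m -> j != m -> e u (b m) \/ e v (b m) ->
    b i \in [:: u; v] /\ sp i m = [::] \/ b j \in [:: u; v] /\ sp j m = [::].
  move=> im jm [/(nb _ _ uQ im jm)|/(nb _ _ vQ im jm)] [] [<- ->];
    by rewrite !inE eqxx ?orbT; auto.
case: (side k ik jk hk) => -[mk Ek]; case: (side l il jl hl) => -[ml El].
- exact: (isolated ik il kl Ek El).
- by have [E _] := eb (both mk ml); apply: (isolated ij ik jk E Ek).
- by have [_ E] := eb (both ml mk); apply: (isolated ji jk ik E Ek).
- exact: (isolated jk jl kl Ek El).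
Qed.

(** If [u] and [v] are adjacent, a common non-neighbour is enclosed by both, against axiom (4). If
    they are distinct and not adjacent, each would enclose the other. *)
Lemma encloser_unique u v x y : inside (F x) (F u) -> inside (F y) (F v) -> u = v.
Proof.
move=> xu yv; apply/eqP; apply/negPn/negP => /eqP uv.
have [euv|nuv] := boolP (e u v).
  have [w [wu wv]] := edge_common_nonneighbour euv.
  exact: (F_nest uv euv (inside_spread xu wu) (inside_spread yv wv)).
have [? ? ? ?] : inside (F v) (F u).
  by apply: inside_spread xu _; rewrite /nonneighbour nuv andbT eq_sym; apply/eqP.
have [? ? ? ?] : inside (F u) (F v).
  apply: inside_spread yv _; rewrite /nonneighbour (K4_edge_sym W) nuv andbT.
  exact/eqP.
lra.
Qed.

Lemma K4path_head i j : i != j -> exists2 y, y \in Q i j & e (b i) y /\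
  (y = b j \/ y \in sp i j).
Proof.
move=> ij; exists (head (b j) (sp i j)).
  by rewrite mem_K4path; case: (sp i j) => [|z L] /=; rewrite ?inE eqxx ?orbT.
split; last by case: (sp i j) => [|z L] /=; [left|right; rewrite mem_head].
apply/(K4_edgeP W); exists i, j; split=> //; rewrite /K4path.
by case: (sp i j) => [|z L] /=; apply/consecP; exists [::]; eexists.
Qed.

Lemma internal_two_neighbours i j x : i != j -> x \in sp i j ->
  exists y z, [/\ y \in Q i j, z \in Q i j, y <> z, e x y & e x z].
Proof.
move=> ij xs; have uQ := K4path_uniq W ij.
have xQ : x \in Q i j by rewrite mem_K4path xs !orbT.
have xi : x <> b i by move=> E; move: xs; rewrite E (negPf (branch_notin_path W _ ij)).
have xj : x <> b j by move=> E; move: xs; rewrite E (negPf (branch_notin_path W _ ij)).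
move def_n: (index x (Q i j)) => n.
have nx : nth (b i) (Q i j) n = x by rewrite -def_n nth_index.
have n_lt : (n < (size (sp i j)).+2)%N by rewrite -(size_path b s i j) -def_n index_mem.
have n_gt : (0 < n)%N by rewrite lt0n; apply/eqP => n0; apply: xi; rewrite -nx n0.
have n_ne : n != (size (sp i j)).+1.
  by apply/eqP => n0; apply: xj; rewrite -nx n0 nth_path_end.
have in_Q m : (m < (size (sp i j)).+2)%N -> nth (b i) (Q i j) m \in Q i j.
  by move=> ?; apply: mem_nth; rewrite size_path.
have ix m : (m < (size (sp i j)).+2)%N -> index (nth (b i) (Q i j) m) (Q i j) = m.
  by move=> ?; rewrite index_uniq ?size_path.
exists (nth (b i) (Q i j) n.-1), (nth (b i) (Q i j) n.+1).
have h1 : (n.-1 < (size (sp i j)).+2)%N by lia.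
have h2 : (n.+1 < (size (sp i j)).+2)%N by lia.
split; rewrite ?in_Q //.
- by move/(congr1 (fun z => index z (Q i j))); rewrite !ix //; lia.
- rewrite (K4_edge_sym W); apply/(K4_edgeP W); exists i, j; split=> //.
  by apply: index_consec => //; rewrite ix // def_n prednK.
- apply/(K4_edgeP W); exists i, j; split=> //.
  by apply: index_consec; rewrite ?in_Q // ix // def_n.
Qed.

(* The vertex of maximal [fx1] on a cycle has two in-neighbours, whose frames both
   contain its left side; being non-adjacent they are nested. *)
Lemma cycle_encloser i j k : i != j -> i != k -> j != k ->
  exists v x, v \in Q i j ++ Q j k ++ Q i k /\ inside (F x) (F v).
Proof.
move=> ij ik jk; set C := _ ++ _.
have [ji ki kj] : [/\ j != i, k != i & k != j] by rewrite ![_ == i]eq_sym ![k == _]eq_sym.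
have Qrev a c x : a != c -> x \in Q a c -> x \in Q c a.
  by move=> ac; rewrite (K4path_rev b s ac) mem_rev.
(* At a branch vertex the two cycle neighbours are the first vertices along two different paths,
   distinct by disjointness. *)
have branch a c d : a != c -> a != d -> c != d ->
    {subset Q a c <= C} -> {subset Q a d <= C} ->
    exists y z, [/\ y \in C, z \in C, y <> z, e (b a) y & e (b a) z].
  move=> ac ad cd sc sd.
  have [y yC [ey hy]] := K4path_head ac; have [z zC [ez hz]] := K4path_head ad.
  exists y, z; split=> //; [exact: sc|exact: sd|move=> yz; subst z].
  case: hy hz => [E1|hy] [E2|hz].
  - by move/eqP: cd; apply; apply: b_inj; rewrite -E1.
  - by move: hz; rewrite E1 (negPf (branch_notin_path W _ ad)).
  - by move: hy; rewrite E2 (negPf (branch_notin_path W _ ac)).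
  - by case: (sym_paths_disjoint W ac ad hy hz) => -[E1 E2]; subst; rewrite eqxx in cd ad.
have [Sij Sjk Sik] : [/\ {subset Q i j <= C}, {subset Q j k <= C} & {subset Q i k <= C}].
  by split=> x xC; rewrite !mem_cat xC ?orbT.
have b0 : b i \in C by rewrite Sij // (branch_in_K4path W) // eqxx.
have [m mC hm] := seq_max (fun x => fx1 (F x)) b0.
have [y [z [yC zC yz ey ez]]] : exists y z, [/\ y \in C, z \in C, y <> z, e m y & e m z].
  have internal a c : a != c -> {subset Q a c <= C} -> m \in sp a c ->
      exists y z, [/\ y \in C, z \in C, y <> z, e m y & e m z].
    move=> ac sub /(internal_two_neighbours ac)[y [z [yQ zQ ? ? ?]]].
    by exists y, z; split=> //; apply: sub.
  have Sji : {subset Q j i <= C} by move=> x /(Qrev _ _ _ ji)/Sij.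
  have Ski : {subset Q k i <= C} by move=> x /(Qrev _ _ _ ki)/Sik.
  have Skj : {subset Q k j <= C} by move=> x /(Qrev _ _ _ kj)/Sjk.
  have [Bi Bj Bk] := And3 (branch i j k ij ik jk Sij Sik) (branch j i k ji jk ik Sji Sjk)
    (branch k i j ki kj ij Ski Skj).
  move: (mC); rewrite !mem_cat !mem_K4path => /or3P[] /or3P[/eqP->|/eqP->|] //;
    exact: internal.
have incoming x : x \in C -> e m x -> frame_arc (F x) (F m).
  move=> xC emx; case: (F_edge (edge_neq emx) emx) => // -[h _ _ _ _].
  by have := hm x xC; lra.
have [? ? ? ? ?] := incoming y yC ey; have [? ? ? ? ?] := incoming z zC ez.
(* Otherwise [m], [y] and [z] would form a triangle. *)
have nyz : ~~ e y z.
  by apply/negP => h; apply: (tf (x := m) (y := y) (z := z)); rewrite [e z m](K4_edge_sym W).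
have [? ?] := F_ok m.
case: (F_nonedge yz nyz) => [h|h|].
- by exists z, y.
- by exists y, z.
- by move=> [?|[?|[?|?]]]; lra.
Qed.

(** The cycle through the three branch vertices other than [k] avoids [b k] and the interiors of the
    paths at [k]. The unique enclosing vertex lies on all four such cycles, but any vertex is missed
    by one of them. *)
Lemma isolated_not_placed : False.
Proof.
have cyc (k : 'I_4) : exists v x, [/\ inside (F x) (F v), v != b k &
    forall i, i != k -> v \notin sp i k].
  have [j kj] : exists j : 'I_4, k != j.
    have [E|ne] := eqVneq k (@Ordinal 4 0 isT); first by exists (@Ordinal 4 1 isT); rewrite E.
    by exists (@Ordinal 4 0 isT).
  have [l [m U]] := ord4_extend kj.
  have [[kl km] [jl jm] lm] : [/\ k != l /\ k != m, j != l /\ j != m & l != m].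
    by move: U; rewrite /= !inE !negb_or => /and4P[/and3P[? ? ?] /andP[? ?] ? _].
  have [v [x [vC xv]]] := cycle_encloser jl jm lm; exists v, x; split=> //.
    apply: contraTneq vC => ->; rewrite !mem_cat !(branch_in_K4path W) //.
    by rewrite (negPf kj) (negPf kl) (negPf km).
  move=> i ik; apply/negP => vs; move: vC; rewrite !mem_cat.
  by case/or3P=> /(internal_in_K4path W ik) h; case: (h _ vs) => // -[E1 E2]; subst;
    rewrite ?eqxx in kj kl km.
have [v [x [xv _ _]]] := cyc ord0.
case: (K4path_cover W v) => [[k E]|[i [j [ij vs]]]].
  have [v' [x' [xv' ne _]]] := cyc k.
  by move: ne; rewrite -(encloser_unique xv xv') E eqxx.
have [v' [x' [xv' _ ne]]] := cyc j.
by move: (ne i ij); rewrite -(encloser_unique xv xv') vs.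
Qed.

End NotFrameGraph.

(** * An explicit family of boxes with natural coordinates *)

Inductive site := Root | Mid | Out | Lane of nat & nat.

Definition site_code (u : site) : nat * nat :=
  match u with Root => (0, 0) | Mid => (0, 1) | Out => (0, 2) | Lane l i => (l.+1, i) end.
Definition site_decode (p : nat * nat) : site :=
  match p with (0, 0) => Root | (0, 1) => Mid | (0, _) => Out | (l.+1, i) => Lane l i end.
Lemma site_codeK : cancel site_code site_decode.
Proof. by case. Qed.
HB.instance Definition _ := Equality.copy site (can_type site_codeK).

Section Sites.
Variables (n : nat -> nat) (k : nat).

(* Lane l is a chain of n l boxes; cross l is the index of the box that crosses the
   right side of Mid.  Only lanes 0 and 1 reach the right side of Out. *)
Definition cross l := if l == 1 then k else (n l).-1.

Definition valid u := if u is Lane l i then (l < 3) && (i < n l) else true.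

(** Directed like [frame_arc]. [Root], [Mid] and [Out] will carry the branch vertices [f] and [a]
    and the vertex [w]. An empty lane 2 means that [f] and [a] are adjacent, hence the arc from
    [Root] to [Mid]. *)
Definition site_arc u v :=
  match u, v with
  | Root, Lane l i => i == 0
  | Root, Mid => n 2 == 0
  | Mid, Lane l i => i == cross l
  | Out, Lane l i => (l != 2) && (i.+1 == n l)
  | Lane l i, Lane l' i' => (l == l') && (i' == i.+1)
  | _, _ => false
  end.

(** [M] exceeds every lane length; [A] and [B] are the abscissas of the right sides of [Mid] and
    [Out], chosen to leave room for boxes spaced 4 apart. *)
Let M := (n 0 + n 1 + n 2).+1.
Let A := 20 + 4 * M.
Let B := A + 4 * M + 20.

(** Boxes after the crossing one are shifted beyond [A], so that only the crossing box meets the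
    right side of [Mid]. *)
Definition lane_pos l i := if i <= cross l then 10 + 4 * i else A + 4 * (i - cross l).

(** With 7 the box of [Root] lies inside [Mid], which starts at 5; with 3 it starts before [Mid],
    which then sticks out of it on the right. *)
Definition X1 u := match u with
  | Root => if n 2 == 0 then 3 else 7
  | Mid => 5
  | Out => 0
  | Lane l i => (lane_pos l i).-1 end.
(** A box ends just after its successor begins, and spacing 4 keeps it away from the next but one.
    The last boxes of lanes 0 and 1 stick out of [Out], that of lane 2 only out of [Mid]. *)
Definition X2 u := match u with
  | Root => 10
  | Mid => A
  | Out => B
  | Lane l i => if i.+1 == n l then (if l == 2 then A + 5 else B.+1)
                else (lane_pos l i.+1).+1 end.
(** Each lane owns a strip of height about [4 * M], in which the vertical ranges shrink by one unit
    at both ends from box to box, as arcs require. *)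
Definition Y1 u := match u with
  | Root => if n 2 == 0 then 3 else 7
  | Mid => 5
  | Out => 0
  | Lane l i => l * (4 * M) + i + 10 end.
Definition Y2 u := match u with
  | Root => 12 * M + (if n 2 == 0 then 17 else 13)
  | Mid => 12 * M + 15
  | Out => 12 * M + 20
  | Lane l i => l * (4 * M) + 4 * M + 8 - i end.

Definition site_frame u := Frame (INR (X1 u)) (INR (X2 u)) (INR (Y1 u)) (INR (Y2 u)).

Hypothesis k_lt : k < n 1.

Lemma lane_length_lt l : l < 3 -> n l < M.
Proof. by case: l => [|[|[|//]]] _; rewrite /M; lia. Qed.

Lemma cross_lt l i : l < 3 -> i < n l -> cross l < n l.
Proof. by rewrite /cross; case: eqP => [->|] //; lia. Qed.

Lemma lane_pos_before l i : i <= cross l -> lane_pos l i = 10 + 4 * i.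
Proof. by rewrite /lane_pos => ->. Qed.

Lemma lane_pos_after l i : cross l < i -> lane_pos l i = A + 4 * (i - cross l).
Proof. by move=> h; rewrite /lane_pos leqNgt h. Qed.

Lemma lane_pos_bounds l i : l < 3 -> i < n l ->
  (10 <= lane_pos l i) && (lane_pos l i + 10 < B).
Proof.
move=> l3 li; have := lane_length_lt l3.
by rewrite /B /lane_pos /A; move: M (cross l) => m c; case: (leqP i c); lia.
Qed.

Lemma lane_pos_step l i j : l < 3 -> i < n l -> i < j -> lane_pos l i + 4 <= lane_pos l j.
Proof.
move=> l3 li ij; have := lane_length_lt l3; rewrite /lane_pos /A.
by move: M (cross l) => m c; case: (leqP i c); case: (leqP j c); lia.
Qed.

Lemma lane_X2_last l i : i.+1 = n l -> X2 (Lane l i) = if l == 2 then A + 5 else B.+1.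
Proof. by move=> h; rewrite /X2 h eqxx. Qed.

Lemma lane_X2_inner l i : i.+1 < n l -> X2 (Lane l i) = (lane_pos l i.+1).+1.
Proof. by move=> h; rewrite /X2 ltn_eqF. Qed.

Variant lane_box_spec l i : nat -> Prop :=
  | LaneLast of i.+1 = n l & l != 2 : lane_box_spec l i B.+1
  | LaneLast2 of i.+1 = n l & l = 2 : lane_box_spec l i (A + 5)
  | LaneInner of i.+1 < n l : lane_box_spec l i (lane_pos l i.+1).+1.

Lemma lane_X2P l i : i < n l -> lane_box_spec l i (X2 (Lane l i)).
Proof.
rewrite leq_eqVlt => /orP[/eqP h|h]; last by rewrite lane_X2_inner //; constructor.
by rewrite lane_X2_last //; case: eqP => [e2|/eqP ne]; constructor.
Qed.

Lemma lane_X2_gt l i : l < 3 -> i < n l -> lane_pos l i + 5 <= X2 (Lane l i).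
Proof.
move=> l3 li; have /andP[_] := lane_pos_bounds l3 li.
case: (lane_X2P li) => [_ _|h l2|h] hB; [lia| |].
  (* In lane 2 the last box is the crossing one, so it still starts before [A]. *)
  have c : i <= cross l by rewrite /cross l2 /= -l2 -h.
  rewrite lane_pos_before // /A; have := lane_length_lt l3; move: M => m; lia.
by have := lane_pos_step l3 li (ltnSn i); lia.
Qed.

Lemma lane_Y l i : l < 3 -> i < n l -> [&& 10 <= Y1 (Lane l i),
  Y1 (Lane l i) < Y2 (Lane l i) & Y2 (Lane l i) < 12 * M + 9].
Proof.
move=> l3 li; have := lane_length_lt l3; rewrite /=.
by case: l l3 li => [|[|[|//]]] _; move: M => m; lia.
Qed.

Lemma lane_Y_apart l i l' i' : l < l' -> l' < 3 -> i < n l -> i' < n l' ->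
  Y2 (Lane l i) < Y1 (Lane l' i').
Proof.
move=> ll l3 li li'; rewrite /=.
have : l.+1 * (4 * M) <= l' * (4 * M) by rewrite leq_mul2r ll orbT.
by rewrite mulSn; move: (_ * (4 * M)) (l' * _) => p q; move: (4 * M) => m; lia.
Qed.

Lemma site_box_ok u : valid u -> (X1 u < X2 u) && (Y1 u < Y2 u).
Proof.
case: u => [_|_|_|l i].
- by rewrite /=; move: M => m; case: ifP => _; lia.
- by rewrite /= /A; move: M => m; lia.
- by rewrite /= /B /A; move: M => m; lia.
move=> /andP[l3 li]; have /and3P[_ -> _] := lane_Y l3 li.
have := lane_X2_gt l3 li; rewrite [X1 _]/=; move: (X2 _) (lane_pos _ _) => p q; lia.
Qed.

(** Counterparts over [nat] of [frame_arc], [inside] and [apart], where comparisons are linear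
    arithmetic; [INR] carries them to the reals. *)
Definition box_arc u v := [&& X1 u < X1 v, X1 v < X2 u, X2 u < X2 v, Y1 u < Y1 v & Y2 v < Y2 u].
Definition box_inside u v := [&& X1 v < X1 u, X2 u < X2 v, Y1 v < Y1 u & Y2 u < Y2 v].
Definition box_apart u v := [|| X2 u < X1 v, X2 v < X1 u, Y2 u < Y1 v | Y2 v < Y1 u].

Lemma root_bounds : [&& 2 < X1 Root, X1 Root < 8, 2 < Y1 Root, Y1 Root < 8,
  12 * M + 12 < Y2 Root & Y2 Root < 12 * M + 18].
Proof. by rewrite /=; move: M => m; case: ifP => _; lia. Qed.

Lemma site_arc_box u v : valid u -> valid v -> site_arc u v -> box_arc u v.
Proof.
rewrite /box_arc; case: u => [|||l i]; case: v => [|||l' i'] //.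
- by move=> _ _ /= ->; rewrite /A; move: M => m; lia.
- move=> _ /andP[l3 li] /eqP i0; rewrite i0 in li *.
  have := lane_Y l3 li; have := root_bounds; have := lane_X2_gt l3 li.
  rewrite [X1 (Lane _ _)]/= lane_pos_before // [X2 Root]/=.
  move: (X2 (Lane _ _)) (X1 Root) (Y1 Root) (Y2 Root) (Y1 (Lane _ _)) (Y2 (Lane _ _)).
  by move: M => m *; lia.
- move=> _ /andP[l3 li] /eqP ic; have := lane_Y l3 li.
  (* The crossing box passes the right side of [Mid]: it ends its lane, or its successor starts
     beyond [A]. *)
  have h : A < X2 (Lane l' i').
    case: (lane_X2P li) => [_ _|_ _|_]; rewrite /B; try by move: A => a; lia.
    by rewrite lane_pos_after ic // subSnn; move: A => a; lia.
  have := lane_length_lt l3; move: h.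
  rewrite [X1 (Lane _ _)]/= lane_pos_before ?ic // [X1 Mid]/= [X2 Mid]/= [Y1 Mid]/= [Y2 Mid]/=.
  rewrite -ic /A; move: (X2 (Lane _ _)) (Y1 (Lane _ _)) (Y2 (Lane _ _)).
  by move: M => m *; lia.
- move=> _ /andP[l3 li] /andP[l2 /eqP il]; have := lane_Y l3 li.
  have := lane_pos_bounds l3 li; rewrite lane_X2_last // (negPf l2).
  rewrite [X1 (Lane _ _)]/= [X1 Out]/= [X2 Out]/= [Y1 Out]/= [Y2 Out]/=.
  move: (Y1 (Lane _ _)) (Y2 (Lane _ _)) (lane_pos _ _).
  by move: M B => m b *; lia.
move=> /andP[l3 li] /andP[_ li'] /andP[/eqP ll /eqP ii]; subst l' i'.
have := lane_X2_gt l3 li'; have := lane_pos_step l3 li (ltnSn i).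
have /andP[+ _] := lane_pos_bounds l3 li.
have -> : (Y1 (Lane l i) < Y1 (Lane l i.+1)) && (Y2 (Lane l i.+1) < Y2 (Lane l i)).
  rewrite /=; have := lane_length_lt l3; move: (l * _) => p.
  by move: M => m; lia.
rewrite (lane_X2_inner li') andbT [X1 (Lane l i)]/= [X1 (Lane l i.+1)]/=.
by move: (X2 _) (lane_pos _ i) (lane_pos _ i.+1) => p q r; lia.
Qed.

Definition box_disjoint u v := [|| box_inside u v, box_inside v u | box_apart u v].

Lemma box_disjoint_sym u v : box_disjoint u v = box_disjoint v u.
Proof.
rewrite /box_disjoint orbCA; congr [|| _, _ | _].
by rewrite /box_apart orbCA; congr [|| _, _ | _]; rewrite orbC.
Qed.

Lemma lane_inside_out l i : l < 3 -> i < n l -> (l == 2) || (i.+1 != n l) ->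
  box_inside (Lane l i) Out.
Proof.
move=> l3 li h; have := lane_Y l3 li; have := lane_pos_bounds l3 li.
have hX : X2 (Lane l i) < B.
  case: (lane_X2P li) h => [il l2|_ _ _|il _].
  - by rewrite il eqxx orbF (negPf l2).
  - by rewrite /B; move: A M => a m; lia.
  - by have := lane_pos_bounds l3 il; move: (lane_pos _ _) B => p b; lia.
rewrite /box_inside hX [X1 (Lane _ _)]/= [X1 Out]/= [Y1 Out]/= [Y2 Out]/=.
move: (Y1 (Lane _ _)) (Y2 (Lane _ _)) (lane_pos _ _).
by move: M B => m b *; lia.
Qed.

(** Boxes before the crossing one are inside [Mid], those after it lie to its right. *)
Lemma lane_mid_disjoint l i : l < 3 -> i < n l -> i != cross l ->
  box_disjoint (Lane l i) Mid.
Proof.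
move=> l3 li; have := lane_length_lt l3; have := cross_lt l3 li.
rewrite neq_ltn => cl lm /orP[ic|ic]; apply/orP; [left|right; apply/orP; right].
  have := lane_Y l3 li; have il : i.+1 < n l by apply: leq_ltn_trans cl.
  rewrite /box_inside lane_X2_inner // [X1 (Lane _ _)]/= !lane_pos_before //; last exact: ltnW.
  rewrite [X1 Mid]/= [X2 Mid]/= [Y1 Mid]/= [Y2 Mid]/= /A.
  move: (Y1 (Lane _ _)) (Y2 (Lane _ _)); move: M lm => m lm *; lia.
rewrite /box_apart [X1 (Lane _ _)]/= lane_pos_after // [X2 Mid]/=.
by apply/orP; right; apply/orP; left; move: A => a; lia.
Qed.

Lemma lane_root_disjoint l i : l < 3 -> i < n l -> i != 0 -> box_disjoint Root (Lane l i).
Proof.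
move=> l3 li i0; apply/orP; right; apply/orP; right; apply/orP; left.
have n0 : 0 < n l by lia.
have := @lane_pos_step l 0 i l3 n0; rewrite lt0n => /(_ i0).
rewrite (@lane_pos_before l 0) //=; move: (lane_pos _ _) => p; lia.
Qed.

Lemma lane_lane_disjoint l i i' : l < 3 -> i' < n l -> i.+1 < i' ->
  box_disjoint (Lane l i) (Lane l i').
Proof.
move=> l3 li' ii; have il := ltn_trans ii li'.
apply/orP; right; apply/orP; right; apply/orP; left.
rewrite lane_X2_inner //=.
by have := lane_pos_step l3 il ii; move: (lane_pos _ _) (lane_pos _ _) => p q; lia.
Qed.

(** [Root] and [Mid] lie inside [Out], and [Root] inside [Mid] unless lane 2 is empty. Different
    lanes are apart vertically, non-consecutive boxes of one lane horizontally. *)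
Lemma site_nonarc_box u v : valid u -> valid v -> u != v ->
  ~~ site_arc u v -> ~~ site_arc v u -> box_disjoint u v.
Proof.
have out_root : box_disjoint Root Out.
  apply/orP; left; rewrite /box_inside; have := root_bounds.
  rewrite [X1 Out]/= [X2 Out]/= [Y1 Out]/= [Y2 Out]/= [X2 Root]/= /B /A.
  by move: (X1 Root) (Y1 Root) (Y2 Root); move: M => m *; lia.
have out_mid : box_disjoint Mid Out.
  by apply/orP; left; rewrite /box_inside /= /B /A; move: M => m; lia.
have root_mid : n 2 != 0 -> box_disjoint Root Mid.
  move=> /negPf h; apply/orP; left; rewrite /box_inside /= h /A.
  by move: M => m; lia.
case: u => [|||l i]; case: v => [|||l' i'] //.
- by move=> _ _ _ /root_mid.
- by move=> _ /andP[l3 li] _ h _; apply: lane_root_disjoint.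
- by move=> _ _ _ _ /root_mid; rewrite box_disjoint_sym.
- move=> _ /andP[l3 li] _ h _; rewrite box_disjoint_sym.
  exact: lane_mid_disjoint.
- by rewrite box_disjoint_sym.
- by rewrite box_disjoint_sym.
- move=> _ /andP[l3 li] _ h _; apply/orP; right; apply/orP; left.
  by apply: lane_inside_out => //; move: h; rewrite /= negb_and negbK.
- by move=> /andP[l3 li] _ _ _ h; rewrite box_disjoint_sym; apply: lane_root_disjoint.
- by move=> /andP[l3 li] _ _ _ h; apply: lane_mid_disjoint.
- move=> /andP[l3 li] _ _ _ h; apply/orP; left.
  by apply: lane_inside_out => //; move: h; rewrite /= negb_and negbK.
move=> /andP[l3 li] /andP[l3' li'] ne h1 h2.
case: (ltngtP l l') => [ll|ll|ll].
- by do 2![apply/orP; right]; rewrite /box_apart lane_Y_apart ?orbT.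
- by do 2![apply/orP; right]; rewrite /box_apart (lane_Y_apart ll) ?orbT.
subst l'; move: ne h1 h2; rewrite /= eqxx /=; case: (ltngtP i i') => [ii|ii|->].
- by move=> _ h _; apply: lane_lane_disjoint => //; rewrite ltn_neqAle eq_sym h.
- move=> _ _ h; rewrite box_disjoint_sym.
  by apply: lane_lane_disjoint => //; rewrite ltn_neqAle eq_sym h.
by rewrite eqxx.
Qed.

(** This yields axiom (4), because [Mid] and [Out] are not adjacent. *)
Lemma box_inside_container u v : valid u -> valid v -> box_inside u v ->
  (v == Mid) || (v == Out).
Proof.
move=> vu vv; case: v vv => [|||l' i'] // vv /and4P[hX1 hX2 hY1 hY2]; exfalso.
  move: hX2; rewrite [X2 Root]/=; case: u vu {hX1 hY1 hY2} => [|||l i] //.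
  move=> /andP[l3 li]; have := lane_X2_gt l3 li; have := lane_pos_bounds l3 li.
  by move: (X2 _) (lane_pos _ _) B => p q b; lia.
case/andP: vv => l3' li'; have /and3P[y1 y2 _] := lane_Y l3' li'.
case: u vu hX1 hX2 hY1 hY2 => [|||l i] vu hX1 hX2 hY1 hY2.
- by have := root_bounds; move: hY1 y1; move: (Y1 _) (Y1 _) => p q *; lia.
- by move: hY1 y1; rewrite [Y1 Mid]/=; move: (Y1 _) => p *; lia.
- by [].
case/andP: vu => l3 li; have /and3P[_ y3 _] := lane_Y l3 li.
case: (ltngtP l l') => [ll|ll|ll].
- have := lane_Y_apart ll l3' li li'; move: hY1 y3.
  by move: (Y1 _) (Y2 _) (Y1 _) => p q r; lia.
- have := lane_Y_apart ll l3 li' li; move: hY2 y3.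
  by move: (Y1 _) (Y2 _) (Y2 _) => p q r; lia.
subst l'; have := lane_pos_bounds l3 li; have := lane_pos_bounds l3 li'.
case: (ltngtP i i') hX1 hX2 => [ii|ii|->]; last by rewrite ltnn.
  have := lane_pos_step l3 li ii; rewrite /=.
  by move: (lane_pos _ _) (lane_pos _ _) B => p q b; lia.
have il : i'.+1 < n l by apply: leq_ltn_trans ii _.
rewrite (lane_X2_inner il); have := lane_X2_gt l3 li.
move: ii; rewrite leq_eqVlt => /orP[/eqP->|ii].
  by move: (X2 _) (lane_pos _ _) => p q; lia.
have := lane_pos_step l3 il ii.
by move: (X2 _) (lane_pos _ _) (lane_pos _ _) => p q r; lia.
Qed.

Lemma ltn_INR a c : a < c -> Rlt (INR a) (INR c).
Proof. by move/ltP; apply: lt_INR. Qed.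

Lemma INR_ltn a c : Rlt (INR a) (INR c) -> a < c.
Proof. by move/INR_lt => h; apply/ltP. Qed.

Lemma restricted_frame_graph_of_sites (T : finType) (e : rel T) (code : T -> site) :
  injective code -> (forall x, valid (code x)) ->
  (forall x y, e x y = site_arc (code x) (code y) || site_arc (code y) (code x)) ->
  restricted_frame_graph e.
Proof.
move=> code_inj vc eE.
have arcF u v : valid u -> valid v -> site_arc u v -> frame_arc (site_frame u) (site_frame v).
  move=> vu vv /(site_arc_box vu vv)/and5P[? ? ? ? ?].
  by split; apply: ltn_INR.
have insF u v : box_inside u v -> inside (site_frame u) (site_frame v).
  by case/and4P=> ? ? ? ?; split; apply: ltn_INR.
have insB u v : inside (site_frame u) (site_frame v) -> box_inside u v.
  by case=> ? ? ? ?; apply/and4P; split; apply: INR_ltn.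
apply: (@restricted_frame_graph_of_placed T e (fun x => site_frame (code x))).
- by move=> v; have /andP[? ?] := site_box_ok (vc v); split; apply: ltn_INR.
- by move=> u v; rewrite eE => /orP[] h; [left|right]; apply: arcF.
- move=> u v /eqP uv; rewrite eE negb_or => /andP[n1 n2].
  have cuv : code u != code v by rewrite (inj_eq code_inj).
  case/or3P: (site_nonarc_box (vc u) (vc v) cuv n1 n2) => h.
  + by constructor 1; apply: insF.
  + by constructor 2; apply: insF.
  + constructor 3; case/or4P: h => /ltn_INR ?; rewrite /apart; tauto.
move=> u v w euv /insB iu /insB iv; move: euv; rewrite eE.
have := box_inside_container (vc w) (vc u) iu.
have := box_inside_container (vc w) (vc v) iv.
by case/orP=> /eqP-> /orP[]/eqP->.
Qed.
End Sites.

(** * Placing a subdivision on the boxes *)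

Lemma consec_mkseq (T : eqType) (g : nat -> T) N x y :
  consec (mkseq g N) x y <-> exists t, [/\ (t.+1 < N)%N, x = g t & y = g t.+1].
Proof.
split=> [[t []]|[t [lt_t -> ->]]].
  by rewrite size_mkseq => lt_t [<- <-]; exists t; rewrite !nth_mkseq // ltnW.
by exists t; rewrite size_mkseq !nth_mkseq // ltnW.
Qed.

Section LaneLayout.
Variables (T : finType) (e : rel T) (b : 'I_4 -> T) (s : 'I_4 -> 'I_4 -> seq T).
Hypothesis W : K4_subdivision_witness e b s.
Notation sp := (sym_paths s).
Notation Q := (K4path b (sym_paths s)).
Variables (a c d f : 'I_4) (G : seq T) (w : T).
Hypothesis U : uniq [:: a; c; d; f].
Hypothesis ac0 : sp a c = [::].
Hypothesis ad0 : sp a d = [::].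
Hypothesis dcE : sp d c = rcons G w.

Let b_inj : injective b. Proof. by case: W. Qed.

(** Lane 0 ends with [b c], whose box crosses both [Mid] and [Out], as [c] is adjacent to [a] and
    [w]. Lane 1 crosses [Mid] at [b d], of index [size (sp f d)], and ends with the neighbour of
    [w]. The last box of lane 2, if any, meets [Mid]. *)
Definition lane l := match l with
  | 0 => rcons (sp f c) (b c)
  | 1 => rcons (sp f d) (b d) ++ G
  | _ => sp f a end.

Definition lane_size l := size (lane l).
Arguments lane_size : simpl never.
Notation n := lane_size.
Notation k := (size (sp f d)).

(* lane 1 continues past b d up to the last internal vertex of the path d-c before w. *)
Definition vertex_at u := match u with
  | Root => b f
  | Mid => b a
  | Out => w
  | Lane l i => nth (b f) (lane l) i end.

(** The type [site] is infinite; with this list of the valid sites, the inverse of [vertex_at] is an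
    index lookup. *)
Definition sites := [:: Root; Mid; Out] ++
  mkseq (Lane 0) (n 0) ++ mkseq (Lane 1) (n 1) ++ mkseq (Lane 2) (n 2).

Lemma valid_sites u : valid n u = (u \in sites).
Proof.
rewrite /sites !mem_cat; apply/idP/idP.
  case: u => // -[|[|[|l]]] i //= h; rewrite !(mem_map, mem_iota) ?h ?orbT //;
    by move=> ? ? [].
by case/or4P=> [|/mapP[i]|/mapP[i]|/mapP[i]]; first (by rewrite !inE => /or3P[]/eqP->);
  rewrite mem_iota => /= h ->.
Qed.

Lemma vertex_at_sites : map vertex_at sites =
  [:: b f; b a; w] ++ lane 0 ++ lane 1 ++ lane 2.
Proof.
rewrite /sites !map_cat; congr (_ ++ _).
have h l : map vertex_at (mkseq (Lane l) (n l)) = lane l.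
  by rewrite -[RHS](mkseq_nth (b f)) /mkseq -map_comp.
by rewrite !h.
Qed.

Lemma branch_neqs : [/\ [/\ a != c, a != d & a != f], c != d /\ c != f & d != f].
Proof.
by move: U; rewrite /= !inE !negb_or => /and4P[/and3P[-> -> ->] /andP[-> ->] -> _].
Qed.

(** The layout rearranges the branch vertices and the interiors of the four paths that may be
    subdivided, so injectivity and covering come from the subdivision. *)
Lemma sites_perm : perm_eq (map vertex_at sites)
  ([:: b f; b a; b c; b d] ++ sp f c ++ sp f d ++ sp f a ++ sp d c).
Proof.
rewrite vertex_at_sites dcE /lane -!cats1; apply/permP => p.
rewrite !count_cat /=; lia.
Qed.

Lemma sites_uniq : uniq (map vertex_at sites).
Proof.
rewrite (perm_uniq sites_perm).
have [[ac ad af] [cd cf] df] := branch_neqs.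
have [fc fd fa dc] : [/\ f != c, f != d, f != a & d != c].
  by rewrite ![f == _]eq_sym [d == c]eq_sym.
have dis i j i' j' : i != j -> i' != j' -> (i != i') || (j != j') -> (i != j') || (j != i') ->
    has (mem (sp i j)) (sp i' j') = false.
  move=> ij ij' h1 h2; apply/hasP => -[x x2 x1].
  by case: (sym_paths_disjoint W ij ij' x1 x2) h1 h2 => -[-> ->]; rewrite !eqxx.
have nb L : has (mem [:: b f; b a; b c; b d]) L =
    [|| b f \in L, b a \in L, b c \in L | b d \in L].
  by rewrite has_sym /= orbF.
rewrite !cat_uniq nb !has_cat !mem_cat !dis ?ac ?ad ?af ?cd ?cf ?df ?fc ?fd ?fa ?dc ?orbT //.
rewrite !(negPf (branch_notin_path W _ _)) // !(sym_paths_uniq W) //=.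
rewrite !inE !(inj_eq b_inj) !negb_or fc fd fa ac ad cd //.
all: by rewrite orbC eq_sym ?ac ?ad.
Qed.

Lemma sites_cover x : x \in map vertex_at sites.
Proof.
rewrite (perm_mem sites_perm).
have [[ac ad af] [cd cf] df] := branch_neqs.
have rv i j : i != j -> (x \in sp j i) = (x \in sp i j).
  by move=> ij; rewrite (sym_paths_rev s ij) mem_rev.
case: (K4path_cover W x) => [[i ->]|[i [j [ij xs]]]].
  have := ord4_cover U i; rewrite mem_cat !inE !(inj_eq b_inj).
  by case/or4P=> ->; rewrite ?orbT.
have [fc fd fa dc] : [/\ f != c, f != d, f != a & d != c].
  by rewrite ![f == _]eq_sym [d == c]eq_sym.
have hi := ord4_cover U i; have hj := ord4_cover U j.
move: hi hj xs ij; rewrite !inE !mem_cat.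
case/or4P=> /eqP-> /or4P[]/eqP->; rewrite ?eqxx // => xs _.
all: move: xs; rewrite ?(rv a c) ?(rv a d) ?ac0 ?ad0 ?in_nil //.
all: rewrite ?(rv d c) ?(rv f c) ?(rv f d) ?(rv f a) //.
all: by move=> ->; rewrite ?orbT.
Qed.

Definition site_of x := nth Root sites (index x (map vertex_at sites)).

Lemma index_lt x : index x (map vertex_at sites) < size sites.
Proof. by rewrite -(size_map vertex_at) index_mem sites_cover. Qed.

Lemma site_ofK : cancel site_of vertex_at.
Proof.
move=> x; rewrite /site_of -(nth_map _ (b f)) ?index_lt //.
by rewrite nth_index ?sites_cover.
Qed.

Lemma vertex_atK u : valid n u -> site_of (vertex_at u) = u.
Proof.
rewrite valid_sites => us; rewrite /site_of.
have lt_u : index u sites < size sites by rewrite index_mem.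
rewrite -[in vertex_at u](nth_index Root us) -(nth_map Root (b f)) //.
by rewrite index_uniq ?size_map ?sites_uniq // nth_index.
Qed.

Lemma site_of_valid x : valid n (site_of x).
Proof. by rewrite valid_sites mem_nth ?index_lt. Qed.

Definition link u v := site_arc n k u v || site_arc n k v u.

Lemma link_sym u v : link u v = link v u.
Proof. by rewrite /link orbC. Qed.

(** The six paths are written as sequences of sites, so that edges become pairs of consecutive
    values of a function. *)
Lemma path_fc : Q f c =
  mkseq (fun t => vertex_at (if t is i.+1 then Lane 0 i else Root)) (n 0).+1.
Proof.
apply: (@eq_from_nth _ (b f)); first by rewrite size_mkseq.
by move=> [|i] h; rewrite nth_mkseq.
Qed.

Lemma path_fd : Q f d =
  mkseq (fun t => vertex_at (if t is i.+1 then Lane 1 i else Root)) k.+2.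
Proof.
apply: (@eq_from_nth _ (b f)); first by rewrite size_mkseq /= size_rcons.
move=> [|i] h; rewrite nth_mkseq //; move: h; rewrite /= ?size_rcons ?ltnS // => h.
by rewrite nth_cat size_rcons ltnS h.
Qed.

Lemma path_fa : Q f a =
  mkseq (fun t => vertex_at (if t is i.+1 then if i < n 2 then Lane 2 i else Mid else Root))
    (n 2).+2.
Proof.
apply: (@eq_from_nth _ (b f)); first by rewrite size_mkseq /= size_rcons.
move=> [|i] h; rewrite nth_mkseq //; move: h; rewrite /= ?size_rcons ?ltnS // => h.
rewrite nth_rcons; case: ltngtP h => //= -> _.
Qed.

Lemma lane0_last : nth (b f) (lane 0) (n 0).-1 = b c.
Proof. by rewrite /lane_size /= size_rcons nth_rcons ltnn eqxx. Qed.

Lemma lane1_cross : nth (b f) (lane 1) k = b d.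
Proof. by rewrite /= nth_cat size_rcons ltnSn nth_rcons ltnn eqxx. Qed.

Lemma path_ac : Q a c =
  mkseq (fun t => vertex_at (if t is 0 then Mid else Lane 0 (n 0).-1)) 2.
Proof. by rewrite /K4path ac0 -lane0_last. Qed.

Lemma path_ad : Q a d = mkseq (fun t => vertex_at (if t is 0 then Mid else Lane 1 k)) 2.
Proof. by rewrite /K4path ad0 -lane1_cross. Qed.

(** Position 0 is [b d], at index [k] of lane 1. The entries of [G] continue that lane, then [w] is
    [Out] and [b c] is the end of lane 0. *)
Lemma path_dc : Q d c =
  mkseq (fun t => vertex_at (if t < (size G).+1 then Lane 1 (k + t)
                             else if t == (size G).+1 then Out else Lane 0 (n 0).-1))
    (size G).+3.
Proof.
apply: (@eq_from_nth _ (b f)); first by rewrite size_mkseq /K4path dcE /= !size_rcons.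
rewrite /K4path dcE => t; rewrite /= !size_rcons !ltnS => h.
rewrite nth_mkseq //; case: ltnP => ht.
  rewrite /= nth_cat size_rcons; case: t h ht => [|t] h ht.
    by rewrite addn0 ltnSn nth_rcons ltnn eqxx.
  rewrite ltnNge (_ : k.+1 <= k + t.+1) /=; last by lia.
  rewrite (_ : k + t.+1 - k.+1 = t); last by lia.
  have [h1 h2] : t < (size G).+1 /\ t < size G by lia.
  by rewrite !nth_rcons size_rcons h1 h2.
case: eqP => [->|ne].
  by rewrite /= !nth_rcons size_rcons ltnSn ltnn eqxx.
have -> : t = (size G).+2 by lia.
by rewrite [vertex_at _]lane0_last /= nth_rcons size_rcons ltnn eqxx.
Qed.

Lemma n0E : n 0 = (size (sp f c)).+1. Proof. by rewrite /lane_size /= size_rcons. Qed.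
Lemma n1E : n 1 = (k + size G).+1. Proof. by rewrite /lane_size /= size_cat size_rcons. Qed.


Lemma edge_linked x y : e x y -> link (site_of x) (site_of y).
Proof.
move=> /(K4_edgeP W)[i [j [ij cxy]]].
suff [u [v [vu vv -> -> uv]]] : exists u v, [/\ valid n u, valid n v,
    x = vertex_at u, y = vertex_at v & link u v] by rewrite !vertex_atK.
have n0 := n0E; have n1 := n1E.
pose good x y := exists u v, [/\ valid n u, valid n v,
    x = vertex_at u, y = vertex_at v & link u v].
have good_sym x' y' : good x' y' -> good y' x'.
  by move=> [u [v [? ? ? ?]]]; rewrite link_sym; exists v, u.
(* Each path is checked in one direction only; [bw] handles the reversed ones. *)
have build i' j' (g : nat -> site) N : Q i' j' = mkseq (fun t => vertex_at (g t)) N ->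
    (forall t, t.+1 < N -> [&& valid n (g t), valid n (g t.+1) & link (g t) (g t.+1)]) ->
    forall x' y', consec (Q i' j') x' y' -> good x' y'.
  move=> -> h x' y' /consec_mkseq[t [/h/and3P[? ? ?] -> ->]].
  by exists (g t), (g t.+1).
have Gfc : forall x' y', consec (Q f c) x' y' -> good x' y'.
  apply: build path_fc _ => -[|t] h; rewrite /link /= ?eqxx ?andbT //; lia.
have Gfd : forall x' y', consec (Q f d) x' y' -> good x' y'.
  apply: build path_fd _ => -[|t] h; rewrite /link /= ?eqxx ?andbT //; lia.
have Gfa : forall x' y', consec (Q f a) x' y' -> good x' y'.
  apply: build path_fa _ => -[|t] h; rewrite /link /=.
    by case: ltnP => //= h'; rewrite ?andbT; lia.
  have h' : t < n 2 by lia.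
  rewrite h'; case: (ltnP t.+1 (n 2)) => h2 /=; rewrite /cross /= ?h' ?eqxx ?andbT //; lia.
have Gac : forall x' y', consec (Q a c) x' y' -> good x' y'.
  by apply: build path_ac _ => -[|t] h //; rewrite /link /= /cross /=; lia.
have Gad : forall x' y', consec (Q a d) x' y' -> good x' y'.
  by apply: build path_ad _ => -[|t] h //; rewrite /link /= /cross /=; lia.
have Gdc : forall x' y', consec (Q d c) x' y' -> good x' y'.
  apply: build path_dc _ => t h; rewrite /link /=.
  case: (ltngtP t.+1 (size G).+1) => h1.
  - by rewrite /= addnS eqxx; lia.
  - have -> : t = (size G).+1 by lia.
    by rewrite eqxx /=; lia.
  - by rewrite /=; lia.
have [[ac ad af] [cd cf] df] := branch_neqs.
have bw i' j' : i' != j' -> (forall x' y', consec (Q i' j') x' y' -> good x' y') ->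
    forall x' y', consec (Q j' i') x' y' -> good x' y'.
  move=> ne h x' y'; rewrite (K4path_rev b s ne) => /consec_rev cc.
  exact/good_sym/h.
have [fc fd fa dc] : [/\ f != c, f != d, f != a & d != c].
  by rewrite ![f == _]eq_sym [d == c]eq_sym.
have hi := ord4_cover U i; have hj := ord4_cover U j.
move: hi hj cxy ij; rewrite !inE.
case/or4P=> /eqP-> /or4P[]/eqP->; rewrite ?eqxx // => cxy _.
all: by [exact: Gac|exact: Gad|exact: Gfc|exact: Gfd|exact: Gfa|exact: Gdc
  |exact: (bw _ _ ac Gac)|exact: (bw _ _ ad Gad)|exact: (bw _ _ fc Gfc)
  |exact: (bw _ _ fd Gfd)|exact: (bw _ _ fa Gfa)|exact: (bw _ _ dc Gdc)].
Qed.

Lemma linked_edge u v : valid n u -> valid n v -> link u v -> e (vertex_at u) (vertex_at v).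
Proof.
wlog: u v / site_arc n k u v.
  move=> h vu vv /orP[uv|vu'].
    by apply: h => //; rewrite /link uv.
  by rewrite (K4_edge_sym W); apply: h => //; rewrite /link vu'.
have [[ac ad af] [cd cf] df] := branch_neqs.
have [fc fd fa dc] : [/\ f != c, f != d, f != a & d != c].
  by rewrite ![f == _]eq_sym [d == c]eq_sym.
have n0 := n0E; have n1 := n1E.
have build i j (g : nat -> site) N t : i != j -> Q i j = mkseq (fun t => vertex_at (g t)) N ->
    t.+1 < N -> e (vertex_at (g t)) (vertex_at (g t.+1)).
  move=> ij E lt_t; apply/(K4_edgeP W); exists i, j; split=> //; rewrite E.
  by apply/consec_mkseq; exists t.
have Bfc t := build _ _ _ _ t fc path_fc.
have Bfd t := build _ _ _ _ t fd path_fd.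
have Bfa t := build _ _ _ _ t fa path_fa.
have Bac := build _ _ _ _ 0 ac path_ac.
have Bad := build _ _ _ _ 0 ad path_ad.
have Bdc t := build _ _ _ _ t dc path_dc.
case: u => [|||l i]; case: v => [|||l' i'] //.
- move=> /eqP h _ _ _; have := Bfa 0 isT.
  by rewrite h.
- case: l' => [|[|[|//]]] /eqP-> _ /andP[_ lt_i] _.
  + exact: (Bfc 0).
  + exact: (Bfd 0).
  + by have := Bfa 0 isT; rewrite lt_i.
- case: l' => [|[|[|//]]] /eqP-> _ /andP[_ lt_i] _.
  + exact: Bac.
  + exact: Bad.
  + rewrite (K4_edge_sym W); have := Bfa (n 2) (ltnSn _).
    move: lt_i; rewrite /cross [2 == 1]/=; case: (n 2) => // m _.
    by rewrite ltnSn ltnn.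
- case: l' => [|[|[|//]]] /andP[_ /eqP h] _ _ _ //.
  + have := Bdc (size G).+1 (ltnSn _).
    by rewrite ltnn eqxx ltnNge leqnSn (gtn_eqF (ltnSn _)) -h.
  + rewrite (K4_edge_sym W); have := Bdc (size G) (ltnW (ltnSn _)).
    rewrite ltnSn ltnn eqxx; have -> // : k + size G = i' by clear -n1 h; lia.
- case: l' => [|[|[|l']]] /andP[/eqP -> /eqP->] /andP[lt_l lt_i] /andP[_ lt_i'] _ //.
  + by apply: (Bfc i.+1).
  (* Up to index [k] lane 1 follows the path from [f] to [d]; afterwards it follows the path from
     [d] to [c] at offset [i - k]. *)
  + case: (leqP i.+1 k) => ik; first exact: (Bfd i.+1).
    have := Bdc (i - k).
    have -> : (i - k).+1 < (size G).+3 by clear -n1 ik lt_i lt_i'; lia.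
    have -> : i - k < (size G).+1 by clear -n1 ik lt_i lt_i'; lia.
    have -> : (i - k).+1 < (size G).+1 by clear -n1 ik lt_i lt_i'; lia.
    have -> : k + (i - k) = i by clear -n1 ik lt_i lt_i'; lia.
    have -> : k + (i - k).+1 = i.+1 by clear -n1 ik lt_i lt_i'; lia.
    exact.
  + by have := Bfa i.+1; rewrite lt_i lt_i'; apply.
Qed.

Lemma lane_layout_restricted : restricted_frame_graph e.
Proof.
apply: (@restricted_frame_graph_of_sites n k _ _ _ site_of).
- by rewrite n1E; lia.
- exact: can_inj site_ofK.
- exact: site_of_valid.
move=> x y; apply/idP/idP; first exact: edge_linked.
by move=> h; rewrite -[x]site_ofK -[y]site_ofK; apply: linked_edge => //; apply: site_of_valid.
Qed.
End LaneLayout.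

(** * Counting subdivided edges *)

Lemma card_ord4_pairs (P : 'I_4 -> 'I_4 -> bool) (o := fun m => @inord 3 m) :
  #|[set p : 'I_4 * 'I_4 | (p.1 < p.2)%N && P p.1 p.2]| =
  P (o 0) (o 1) + P (o 0) (o 2) + P (o 0) (o 3) +
  P (o 1) (o 2) + P (o 1) (o 3) + P (o 2) (o 3).
Proof.
rewrite -sum1dep_card big_mkcond /=.
rewrite -(pair_bigA _ (fun i j : 'I_4 => if (i < j)%N && P i j then 1 else 0)) /=.
rewrite !big_ord_recl !big_ord0 /=.
have -> : lift ord0 ord0 = o 1 :> 'I_4 by apply: val_inj; rewrite /= inordK.
have -> : lift ord0 (lift ord0 ord0) = o 2 :> 'I_4 by apply: val_inj; rewrite /= inordK.
have -> : lift ord0 (lift ord0 (lift ord0 ord0)) = o 3 :> 'I_4 by apply: val_inj; rewrite /= inordK.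
have -> : ord0 = o 0 :> 'I_4 by apply: val_inj; rewrite /= inordK.
by do 6![case: (P _ _)].
Qed.

Lemma subdivided_sym (T : finType) (s : 'I_4 -> 'I_4 -> seq T) i j : i != j ->
  subdivided s i j = subdivided s j i.
Proof. by rewrite /subdivided; case: ltngtP => // /val_inj->; rewrite eqxx. Qed.

(** Unsubdivided edges without a common vertex form a matching of [K4], hence number at most two.
    The twelve instances below run over a centre and two of its edges. *)
Lemma few_subdivided_share (T : finType) (s : 'I_4 -> 'I_4 -> seq T) :
  (num_subdivided s <= 3)%N -> nonsubdivided_share_vertex s.
Proof.
rewrite /num_subdivided card_ord4_pairs.
pose o m : 'I_4 := inord m.
have oo m m' : (m < 4)%N -> (m' < 4)%N -> (o m == o m') = (m == m').
  by move=> h h'; rewrite -val_eqE /= !inordK.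
have sym x y : (x < 4)%N -> (y < 4)%N -> x != y ->
    subdivided s (o x) (o y) = subdivided s (o y) (o x).
  by move=> x4 y4 xy; apply: subdivided_sym; rewrite oo.
have share x y z : (x < 4)%N -> (y < 4)%N -> (z < 4)%N -> [&& x != y, x != z & y != z] ->
    nonsubdivided_share_vertex s \/ subdivided s (o x) (o y) || subdivided s (o x) (o z).
  move=> x4 y4 z4 /and3P[xy xz yz].
  case: (boolP (_ || _)) => [|/norP[sy sz]]; [by right|left].
  by exists (o x), (o y), (o z); rewrite !oo.
rewrite -/(o 0) -/(o 1) -/(o 2) -/(o 3).
have [//|] := share 0 1 2 isT isT isT isT; have [//|] := share 0 1 3 isT isT isT isT.
have [//|] := share 0 2 3 isT isT isT isT; have [//|] := share 1 0 2 isT isT isT isT.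
have [//|] := share 1 0 3 isT isT isT isT; have [//|] := share 1 2 3 isT isT isT isT.
have [//|] := share 2 0 1 isT isT isT isT; have [//|] := share 2 0 3 isT isT isT isT.
have [//|] := share 2 1 3 isT isT isT isT; have [//|] := share 3 0 1 isT isT isT isT.
have [//|] := share 3 0 2 isT isT isT isT; have [//|] := share 3 1 2 isT isT isT isT.
rewrite (sym 1 0) // (sym 2 0) // (sym 3 0) // (sym 2 1) // (sym 3 1) // (sym 3 2) //.
by do 6![case: (subdivided _ _ _)].
Qed.

Lemma share_subdivided_le4 (T : finType) (s : 'I_4 -> 'I_4 -> seq T) :
  nonsubdivided_share_vertex s -> (num_subdivided s <= 4)%N.
Proof.
move=> [a [c [d [ac ad cd sac sad]]]].
(* The count ranges over increasing pairs, so the two unsubdivided edges are first put in that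
   form. *)
pose op (i j : 'I_4) := if (i < j)%N then (i, j) else (j, i).
pose E := [set p : 'I_4 * 'I_4 | (p.1 < p.2)%N && true].
have opE i j : i != j -> op i j \in E.
  by rewrite neq_ltn inE /op andbT; case: ifP => [->|].
have cE : #|E| = 6 by exact: (card_ord4_pairs (fun _ _ => true)).
have ne : op a c != op a d.
  rewrite /op; case: ifP => _; case: ifP => _; rewrite xpair_eqE ?eqxx //= ?(negPf cd) //.
  - by rewrite (negPf ad).
  - by rewrite eq_sym (negPf ac).
have sop i j : i != j -> subdivided s (op i j).1 (op i j).2 = subdivided s i j.
  by move=> ij; rewrite /op; case: ifP => // _; rewrite subdivided_sym // eq_sym.
have sub2 : [set op a c; op a d] \subset E by rewrite subUset !sub1set !opE.
have -> : 4 = #|E :\: [set op a c; op a d]|.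
  by rewrite cardsD (setIidPr sub2) cE cards2 ne.
apply: subset_leq_card; apply/subsetP => p; rewrite !inE andbT => /andP[-> sp].
rewrite andbT; apply/negP => /orP[]/eqP Ep; move: sp; rewrite Ep sop //.
- by rewrite (negPf sac).
- by rewrite (negPf sad).
Qed.

(** * The equivalence *)

Theorem theoremA1 (T : finType) (e : rel T) :
  triangle_free e -> is_K4_subdivision e ->
  (restricted_frame_graph e <->
   exists (b : 'I_4 -> T) (s : 'I_4 -> 'I_4 -> seq T),
     K4_subdivision_witness e b s /\
     ((num_subdivided s <= 3)%N \/
      (num_subdivided s = 4 /\ nonsubdivided_share_vertex s))).
Proof.
move=> tf [b0 [s0 W0]]; split.
  move=> rfg; exists b0, s0; split=> //.
  (* Two unsubdivided edges leave at most four subdivided ones: exactly four, or at most three. *)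
  suff sh : nonsubdivided_share_vertex s0.
    have := share_subdivided_le4 sh; rewrite leq_eqVlt => /orP[/eqP|]; auto.
  have [F [Fok Fe Fn F4]] := restricted_frame_graph_placed rfg.
  have [/existsP[a /existsP[c /existsP[d /and5P[]]]]|no] := boolP [exists a, exists c, exists d,
     [&& a != c, a != d, c != d, ~~ subdivided s0 a c & ~~ subdivided s0 a d]].
    by move=> ? ? ? ? ?; exists a, c, d.
  exfalso; apply: (isolated_not_placed W0 tf _ Fok Fe Fn F4) => i j k ij ik jk ej ek.
  move/negP: no; apply; apply/existsP; exists i; apply/existsP; exists j; apply/existsP; exists k.
  by rewrite ij ik jk !subdividedE // ej ek.
move=> [b [s [W h]]].
have [a [c [d [ac ad cd]]]] : nonsubdivided_share_vertex s.
  by case: h => [/few_subdivided_share|[_]].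
rewrite !subdividedE // !negbK => /eqP ac0 /eqP ad0.
(* Of the two indices other than [a] and [c], [f] is the one different from [d]. *)
have [f U] : exists f, uniq [:: a; c; d; f].
  have [x [y]] := ord4_extend ac; rewrite /= !inE !negb_or.
  move=> /and4P[/and3P[_ ax ay] /andP[cx cy] xy _].
  have [dx|dx] := eqVneq d x.
    by exists y; rewrite !inE !negb_or ac ad ay cd cy dx xy.
  by exists x; rewrite !inE !negb_or ac ad ax cd cx dx.
have dc : d != c by rewrite eq_sym.
(* Otherwise the branch vertices of [a], [c], [d] form a triangle. So the path from [d] to [c] has a
   last internal vertex [w]. *)
have : sym_paths s d c <> [::].
  move=> dc0; apply: (tf (b a) (b c) (b d)).
  rewrite [e (b c) _](K4_edge_sym W) [e (b d) (b a)](K4_edge_sym W).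
  by rewrite !(branch_edge W) // ac0 dc0 ad0.
case/lastP E: (sym_paths s d c) => [//|G w] _.
exact: (lane_layout_restricted W U ac0 ad0 E).
Qed.
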